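(* Let $R$ be an $\mathbb{F}_p$-algebra whose Frobenius $\varphi\colon R\to R$ is flat and which has global dimension $d$ (e.g., a regular noetherian $\mathbb{F}_p$-algebra of Krull dimension $d$). Then the abelian category of unit $R[F]$-modules has global dimension $\leq d+1$.
   Context: $p$ is a prime. $R[F]$ is the free associative algebra over $R$ on $F$ with relations $Fa=a^pF$, $a\in R$. A left $R[F]$-module $M$ is unit if the $R$-linear map $\varphi^*M\to M$ adjoint to $F\colon M\to\varphi_*M$ is an isomorphism; unit modules form an abelian subcategory of all left $R[F]$-modules when $\varphi$ is flat. An abelian category has global dimension $\leq n$ if $\mathrm{Ext}^i(X,Y)=0$ for all objects $X,Y$ and all $i>n$. *)

(* Defs.v *)
From Stdlib Require Import Relation_Operators.
From HB Require Import structures.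
From mathcomp Require Import all_boot all_order all_algebra.
From mathcomp Require Import generic_quotient boolp.

Set Implicit Arguments.
Unset Strict Implicit.
Unset Printing Implicit Defensive.

Import GRing.Theory.
Local Open Scope ring_scope.
Local Open Scope quotient_scope.

(* In an abelian category, zero morphisms, kernels and cokernels are          *)
(* determined by the underlying category, so that Yoneda Ext and the global   *)
(* dimension below need no further structure.                                 *)

Record category := Category {
  obj :> Type;
  hom : obj -> obj -> Type;
  idm : forall X, hom X X;
  comp : forall X Y Z, hom Y Z -> hom X Y -> hom X Z;
  comp_idl : forall X Y (f : hom X Y), comp (idm Y) f = f;
  comp_idr : forall X Y (f : hom X Y), comp f (idm X) = f;
  compA : forall X Y Z W (f : hom Z W) (g : hom Y Z) (h : hom X Y),
    comp f (comp g h) = comp (comp f g) h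
}.

Definition full_subcategory (C : category) (P : C -> Prop) : category :=
  @Category {X : C | P X} (fun X Y => hom (sval X) (sval Y))
    (fun X => idm (sval X)) (fun X Y Z f g => comp f g)
    (fun X Y f => comp_idl f) (fun X Y f => comp_idr f)
    (fun X Y Z W f g h => compA f g h).

Section Ext.
Variable C : category.
Implicit Types X Y Z K : C.

Definition zero_object Z : Prop :=
  forall X, (exists! _ : hom X Z, True) /\ (exists! _ : hom Z X, True).

Definition zero_morphism X Y (f : hom X Y) : Prop :=
  exists Z (u : hom X Z) (v : hom Z Y), zero_object Z /\ f = comp v u.

Definition is_kernel K X Y (i : hom K X) (f : hom X Y) : Prop :=
  zero_morphism (comp f i) /\
  forall T (u : hom T X), zero_morphism (comp f u) ->
    exists! v : hom T K, comp i v = u.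

Definition is_cokernel X Y Q (q : hom Y Q) (f : hom X Y) : Prop :=
  zero_morphism (comp q f) /\
  forall T (u : hom Y T), zero_morphism (comp u f) ->
    exists! v : hom Q T, comp v q = u.

(* 0 -> Y -> ses_mid -> X -> 0 *)
Record short_exact_sequence X Y := ShortExactSequence {
  ses_mid : C;
  ses_inc : hom Y ses_mid;
  ses_prj : hom ses_mid X;
  ses_kernel : is_kernel ses_inc ses_prj;
  ses_cokernel : is_cokernel ses_prj ses_inc
}.

(* Yoneda n-extensions of X by Y: morphisms X -> Y for n = 0, and for n >= 1  *)
(* exact sequences 0 -> Y -> E_n -> ... -> E_1 -> X -> 0, presented as the    *)
(* splicing of n short exact sequences: K is the kernel of E_1 -> X, and the  *)
(* remaining terms form an (n-1)-extension of K by Y.                         *)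
Fixpoint extension (n : nat) X Y : Type :=
  match n with
  | 0 => hom X Y
  | n'.+1 => match n' with
             | 0 => short_exact_sequence X Y
             | _.+1 =>
                 {K : C & (short_exact_sequence X K * extension n' K Y)%type}
             end
  end.

Definition ses_morphism X Y X' Y' (a : hom X X') (b : hom Y Y')
    (E : short_exact_sequence X Y) (E' : short_exact_sequence X' Y') : Prop :=
  exists e : hom (ses_mid E) (ses_mid E'),
    comp e (ses_inc E) = comp (ses_inc E') b /\
    comp (ses_prj E') e = comp a (ses_prj E).

(* There is a morphism of exact sequences E -> E' that is a on the X-end and  *)
(* the identity on Y.                                                         *)
Fixpoint extension_morphism (n : nat) X X' Y (a : hom X X') :
    extension n X Y -> extension n X' Y -> Prop :=
  match n return extension n X Y -> extension n X' Y -> Prop with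
  | 0 => fun f f' => f = comp f' a
  | n'.+1 =>
    match n' return
      (forall K K' (k : hom K K'), extension n' K Y -> extension n' K' Y -> Prop) ->
      extension n'.+1 X Y -> extension n'.+1 X' Y -> Prop
    with
    | 0 => fun _ E E' => ses_morphism a (idm Y) E E'
    | _.+1 => fun rec E E' =>
        exists k : hom (projT1 E) (projT1 E'),
          ses_morphism a k (projT2 E).1 (projT2 E').1 /\
          rec _ _ k (projT2 E).2 (projT2 E').2
    end (fun K K' k => @extension_morphism n' K K' Y k)
  end.

Definition yoneda_equivalent n X Y : extension n X Y -> extension n X Y -> Prop :=
  clos_refl_sym_trans _ (extension_morphism (idm X)).

(* Ext^n(X, Y) is the set of Yoneda classes of n-extensions; being a group    *)
(* for the Baer sum, it vanishes iff it has only one element.                 *)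
Definition Ext_vanishes n X Y : Prop :=
  forall E E' : extension n X Y, yoneda_equivalent E E'.

Definition gldim_le (n : nat) : Prop :=
  forall i : nat, (n < i)%N -> forall X Y, Ext_vanishes i X Y.

Definition has_gldim (d : nat) : Prop :=
  gldim_le d /\ forall n, gldim_le n -> (d <= n)%N.

End Ext.

Lemma linear_ext (R : pzRingType) (M N : lmodType R) (f g : {linear M -> N}) :
  f =1 g -> f = g.
Proof.
case: f => f cf; case: g => g cg /= fg.
have {}fg : f = g by apply: funext.
case: _ / fg cg => cg; congr GRing.Linear.Pack.
case: cf => [[m1] [m2]]; case: cg => [[n1] [n2]].
by rewrite (Prop_irrelevance m1 n1) (Prop_irrelevance m2 n2).
Qed.

Definition module_category (R : pzRingType) : category.
Proof.
refine (@Category (lmodType R) (fun M N => {linear M -> N})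
  (fun M => idfun : {linear M -> M})
  (fun M N P g f => (g \o f : {linear M -> P})) _ _ _).
- by move=> M N f; apply: linear_ext.
- by move=> M N f; apply: linear_ext.
- by move=> M N P Q f g h; apply: linear_ext.
Defined.

Definition restrict (R S : pzRingType) (f : {rmorphism R -> S})
  (M : lmodType S) : Type := M.

Section Restrict.
Variables (R S : pzRingType) (f : {rmorphism R -> S}) (M : lmodType S).

HB.instance Definition _ := GRing.Zmodule.on (restrict f M).

Let scale (a : R) (m : restrict f M) : restrict f M := f a *: (m : M).

Let scaleA a b m : scale a (scale b m) = scale (a * b) m.
Proof. by rewrite /scale rmorphM scalerA. Qed.
Let scale1 : left_id 1 scale.
Proof. by move=> m; rewrite /scale rmorph1 scale1r. Qed.
Let scaleDr : right_distributive scale +%R.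
Proof. by move=> a m n; rewrite /scale scalerDr. Qed.
Let scaleDl m : {morph scale^~ m : a b / a + b}.
Proof. by move=> a b; rewrite /scale rmorphD scalerDl. Qed.

HB.instance Definition _ :=
  GRing.Zmodule_isLmodule.Build R (restrict f M) scaleA scale1 scaleDr scaleDl.

End Restrict.

Section Tensor.
Variables (R S : pzRingType) (f : {rmorphism R -> S}) (M : lmodType R).

Inductive tterm : Type :=
| TPure of S & M
| TZero
| TOpp of tterm
| TAdd of tterm & tterm.

(* S (x)_R M is the abelian group with generators s (x) m and the relations   *)
(* below, S being a right R-module through f.                                 *)
Inductive teq : tterm -> tterm -> Prop :=
| teq_refl x : teq x x
| teq_sym x y : teq x y -> teq y x
| teq_trans y x z : teq x y -> teq y z -> teq x z
| teq_opp x x' : teq x x' -> teq (TOpp x) (TOpp x')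
| teq_add x x' y y' : teq x x' -> teq y y' -> teq (TAdd x y) (TAdd x' y')
| teq_addA x y z : teq (TAdd x (TAdd y z)) (TAdd (TAdd x y) z)
| teq_addC x y : teq (TAdd x y) (TAdd y x)
| teq_add0 x : teq (TAdd TZero x) x
| teq_addN x : teq (TAdd (TOpp x) x) TZero
| teq_pureDl s t m : teq (TPure (s + t) m) (TAdd (TPure s m) (TPure t m))
| teq_pureDr s m n : teq (TPure s (m + n)) (TAdd (TPure s m) (TPure s n))
| teq_pureM s a m : teq (TPure (s * f a) m) (TPure s (a *: m)).

HB.instance Definition _ := gen_eqMixin tterm.
HB.instance Definition _ := gen_choiceMixin tterm.

Definition teqb (x y : tterm) : bool := `[< teq x y >].

Lemma teqb_refl : reflexive teqb.
Proof. by move=> x; apply/asboolP/teq_refl. Qed.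
Lemma teqb_sym : symmetric teqb.
Proof. by move=> x y; apply/asboolP/asboolP; apply: teq_sym. Qed.
Lemma teqb_trans : transitive teqb.
Proof. by move=> y x z /asboolP xy /asboolP yz; apply/asboolP/(teq_trans xy). Qed.

Canonical teq_equiv := EquivRel teqb teqb_refl teqb_sym teqb_trans.

Definition extend : Type := {eq_quot teqb}.
HB.instance Definition _ := Choice.on extend.
HB.instance Definition _ := Quotient.on extend.

Definition tclass (x : tterm) : extend := \pi_extend x.
Definition pure (s : S) (m : M) : extend := tclass (TPure s m).

Lemma tclassP x y : tclass x = tclass y <-> teq x y.
Proof.
by split=> [/(@eqmodP _ teq_equiv)/asboolP|xy] //; apply/(@eqmodP _ teq_equiv)/asboolP.
Qed.

Lemma tclassK (q : extend) : tclass (repr q) = q.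
Proof. exact: reprK. Qed.

Let zero : extend := tclass TZero.
Let opp (q : extend) : extend := tclass (TOpp (repr q)).
Let add (q r : extend) : extend := tclass (TAdd (repr q) (repr r)).

Lemma repr_tclass x : teq (repr (tclass x)) x.
Proof. by apply/tclassP; rewrite tclassK. Qed.

Let oppE x : opp (tclass x) = tclass (TOpp x).
Proof. by apply/tclassP/teq_opp/repr_tclass. Qed.
Let addE x y : add (tclass x) (tclass y) = tclass (TAdd x y).
Proof. by apply/tclassP/teq_add; apply: repr_tclass. Qed.

Let addA : associative add.
Proof.
move=> x y z; rewrite -(tclassK x) -(tclassK y) -(tclassK z) !addE.
exact/tclassP/teq_addA.
Qed.
Let addC : commutative add.
Proof.
by move=> x y; rewrite -(tclassK x) -(tclassK y) !addE; apply/tclassP/teq_addC.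
Qed.
Let add0 : left_id zero add.
Proof. by move=> x; rewrite -(tclassK x) addE; apply/tclassP/teq_add0. Qed.
Let addN : left_inverse zero opp add.
Proof. by move=> x; rewrite -(tclassK x) oppE addE; apply/tclassP/teq_addN. Qed.

HB.instance Definition _ :=
  GRing.isZmodule.Build extend addA addC add0 addN.

Lemma tclass0 : tclass TZero = 0. Proof. by []. Qed.
Lemma tclassN x : tclass (TOpp x) = - tclass x. Proof. exact/esym/oppE. Qed.
Lemma tclassD x y : tclass (TAdd x y) = tclass x + tclass y.
Proof. exact/esym/addE. Qed.

Lemma pureDl s t m : pure (s + t) m = pure s m + pure t m.
Proof. by rewrite -tclassD; apply/tclassP/teq_pureDl. Qed.
Lemma pureDr s m n : pure s (m + n) = pure s m + pure s n.
Proof. by rewrite -tclassD; apply/tclassP/teq_pureDr. Qed.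
Lemma pureM s a m : pure (s * f a) m = pure s (a *: m).
Proof. exact/tclassP/teq_pureM. Qed.

Lemma extend_ind (P : extend -> Prop) :
  (forall s m, P (pure s m)) -> P 0 -> (forall q, P q -> P (- q)) ->
  (forall q r, P q -> P r -> P (q + r)) -> forall q, P q.
Proof.
move=> Pp P0 PN PD q; rewrite -(tclassK q); elim: (repr q) => //=.
- by move=> x; rewrite tclassN; apply: PN.
- by move=> x Px y Py; rewrite tclassD; apply: PD.
Qed.

Section Lift.
Variables (V : zmodType) (g : S -> M -> V).
Hypothesis gDl : forall s t m, g (s + t) m = g s m + g t m.
Hypothesis gDr : forall s m n, g s (m + n) = g s m + g s n.
Hypothesis gM : forall s a m, g (s * f a) m = g s (a *: m).

Fixpoint teval (x : tterm) : V :=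
  match x with
  | TPure s m => g s m
  | TZero => 0
  | TOpp x => - teval x
  | TAdd x y => teval x + teval y
  end.

Lemma teval_teq x y : teq x y -> teval x = teval y.
Proof.
elim=> //= {x y}.
- by move=> y x z _ -> _ ->.
- by move=> x x' _ ->.
- by move=> x x' y y' _ -> _ ->.
- by move=> x y z; rewrite addrA.
- by move=> x y; rewrite addrC.
- by move=> x; rewrite add0r.
- by move=> x; rewrite addNr.
Qed.

Definition tlift (q : extend) : V := teval (repr q).

Lemma tlift_tclass x : tlift (tclass x) = teval x.
Proof. exact/teval_teq/repr_tclass. Qed.

Lemma tlift_pure s m : tlift (pure s m) = g s m.
Proof. exact: tlift_tclass. Qed.

Lemma tliftD q r : tlift (q + r) = tlift q + tlift r.
Proof. by rewrite -(tclassK q) -(tclassK r) -tclassD !tlift_tclass. Qed.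

Lemma tliftN q : tlift (- q) = - tlift q.
Proof. by rewrite -(tclassK q) -tclassN !tlift_tclass. Qed.

Lemma tlift0 : tlift 0 = 0.
Proof. by rewrite -tclass0 tlift_tclass. Qed.

End Lift.

Let escale (s : S) : extend -> extend := tlift (fun t m => pure (s * t) m).

Let escaleDl_ s t u m : pure (s * (t + u)) m = pure (s * t) m + pure (s * u) m.
Proof. by rewrite mulrDr pureDl. Qed.
Let escaleM_ s t a m : pure (s * (t * f a)) m = pure (s * t) (a *: m).
Proof. by rewrite mulrA pureM. Qed.

Let escale_pure s t m : escale s (pure t m) = pure (s * t) m.
Proof.
by apply: tlift_pure; [exact: escaleDl_ | move=> *; exact: pureDr | exact: escaleM_].
Qed.
Let escaleDr : right_distributive escale +%R.
Proof.
move=> s q r.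
by apply: tliftD; [exact: escaleDl_ | move=> *; exact: pureDr | exact: escaleM_].
Qed.
Let escaleN s q : escale s (- q) = - escale s q.
Proof.
by apply: tliftN; [exact: escaleDl_ | move=> *; exact: pureDr | exact: escaleM_].
Qed.
Let escale0 s : escale s 0 = 0.
Proof.
by apply: tlift0; [exact: escaleDl_ | move=> *; exact: pureDr | exact: escaleM_].
Qed.

Let escaleA s t q : escale s (escale t q) = escale (s * t) q.
Proof.
elim/extend_ind: q => [u m||q IH|q r IHq IHr].
- by rewrite !escale_pure mulrA.
- by rewrite !escale0.
- by rewrite !escaleN IH.
- by rewrite !escaleDr IHq IHr.
Qed.
Let escale1 : left_id 1 escale.
Proof.
elim/extend_ind => [u m||q IH|q r IHq IHr].
- by rewrite escale_pure mul1r.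
- by rewrite escale0.
- by rewrite escaleN IH.
- by rewrite escaleDr IHq IHr.
Qed.
Let escaleDl q : {morph escale^~ q : s t / s + t}.
Proof.
move=> s t; elim/extend_ind: q => [u m||q IH|q r IHq IHr].
- by rewrite !escale_pure mulrDl pureDl.
- by rewrite !escale0 addr0.
- by rewrite !escaleN IH opprD.
- by rewrite !escaleDr IHq IHr addrACA.
Qed.

HB.instance Definition _ :=
  GRing.Zmodule_isLmodule.Build S extend escaleA escale1 escaleDr escaleDl.

Lemma scale_pure s t m : s *: pure t m = pure (s * t) m.
Proof. exact: escale_pure. Qed.

Definition extend_unit (m : M) : restrict f extend := pure 1 m.

Lemma extend_unit_is_linear : linear extend_unit.
Proof.
move=> a m n; rewrite /extend_unit pureDr -pureM mul1r; congr (_ + _).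
by rewrite [RHS]scale_pure mulr1.
Qed.

HB.instance Definition _ :=
  GRing.isLinear.Build R M (restrict f extend) *:%R extend_unit
    extend_unit_is_linear.

(* The S-linear map S (x)_R M -> N, s (x) m |-> s g(m), adjoint to an         *)
(* R-linear g : M -> restrict f N.                                            *)
Section Adjoint.
Variables (N : lmodType S) (g : {linear M -> restrict f N}).

Let ev (s : S) (m : M) : N := s *: (g m : N).

Let evDl s t m : ev (s + t) m = ev s m + ev t m.
Proof. exact: scalerDl. Qed.
Let evDr s m n : ev s (m + n) = ev s m + ev s n.
Proof. by rewrite /ev raddfD scalerDr. Qed.
Let evM s a m : ev (s * f a) m = ev s (a *: m).
Proof. by rewrite /ev linearZ -scalerA. Qed.

Definition adjoint_fun : extend -> N := tlift (fun s m => s *: (g m : N)).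

Lemma adjoint_pure s m : adjoint_fun (pure s m) = s *: (g m : N).
Proof. exact: (tlift_pure evDl evDr evM). Qed.

Lemma adjoint_is_linear : linear adjoint_fun.
Proof.
move=> s q r; rewrite /adjoint_fun (tliftD evDl evDr evM); congr (_ + _).
elim/extend_ind: q => [u m||q IH|q q' IHq IHr].
- by rewrite scale_pure -![tlift _ _]/(adjoint_fun _) !adjoint_pure scalerA.
- by rewrite scaler0 (tlift0 evDl evDr evM) scaler0.
- by rewrite scalerN !(tliftN evDl evDr evM) IH scalerN.
- by rewrite scalerDr !(tliftD evDl evDr evM) IHq IHr scalerDr.
Qed.

HB.instance Definition _ :=
  GRing.isLinear.Build S extend N *:%R adjoint_fun adjoint_is_linear.

Definition adjoint : {linear extend -> N} := adjoint_fun.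

End Adjoint.

End Tensor.

Definition extend_map (R S : pzRingType) (f : {rmorphism R -> S})
    (M N : lmodType R) (g : {linear M -> N}) :
    {linear extend f M -> extend f N} :=
  adjoint (@extend_unit R S f N \o g : {linear M -> restrict f (extend f N)}).

Definition exact_at (R : pzRingType) (L M N : lmodType R)
    (g : {linear L -> M}) (h : {linear M -> N}) : Prop :=
  forall m : M, h m = 0 <-> exists l : L, g l = m.

Definition flat (R S : pzRingType) (f : {rmorphism R -> S}) : Prop :=
  forall (L M N : lmodType R) (g : {linear L -> M}) (h : {linear M -> N}),
    exact_at g h -> exact_at (extend_map f g) (extend_map f h).

(* The zero ring is allowed, so that R being an F_p-algebra is expressed as   *)
(* p%:R = 0 rather than p \in [pchar R].                                      *)

Definition frobenius (R : comPzRingType) (p : nat) (p_prime : prime p)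
  (p0 : p%:R = 0 :> R) (x : R) : R := x ^+ p.

Section Frobenius.
Variables (R : comPzRingType) (p : nat) (p_prime : prime p).
Variable p0 : p%:R = 0 :> R.

Let frobeniusD (x y : R) : (x + y) ^+ p = x ^+ p + y ^+ p.
Proof.
rewrite exprDn; case: (p) p0 p_prime => // q q0 q_prime.
rewrite big_ord_recr big_ord_recl /= subnn bin0 binn !mulr1n.
rewrite !expr0 subn0 mul1r mulr1 big1 ?addr0 // => i _.
have /dvdnP[k ->] : (q.+1 %| 'C(q.+1, bump 0 i))%N.
  by apply: prime_dvd_bin => //; rewrite /bump /= add1n ltnS ltn_ord.
by rewrite mulrnA -mulr_natr q0 mulr0.
Qed.

Let frobenius_is_zmod : zmod_morphism (frobenius p_prime p0).
Proof.
move=> x y; rewrite /frobenius; apply/eqP; rewrite eq_sym subr_eq.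
by rewrite -frobeniusD subrK.
Qed.

Let frobenius_is_monoid : monoid_morphism (frobenius p_prime p0).
Proof.
by split=> [|x y]; rewrite /frobenius ?expr1n // exprMn.
Qed.

HB.instance Definition _ :=
  GRing.isZmodMorphism.Build R R (frobenius p_prime p0) frobenius_is_zmod.
HB.instance Definition _ :=
  GRing.isMonoidMorphism.Build R R (frobenius p_prime p0) frobenius_is_monoid.

End Frobenius.

(* R[F] is presented as the ring generated by the ring R and an element F,    *)
(* with the relations F a = a ^+ p F.                                         *)

Section TwistedRing.
Variables (R : comPzRingType) (p : nat).

Inductive fterm : Type :=
| FConst of R
| FVar
| FOpp of fterm
| FAdd of fterm & fterm
| FMul of fterm & fterm.

Inductive feq : fterm -> fterm -> Prop :=
| feq_refl x : feq x x
| feq_sym x y : feq x y -> feq y x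
| feq_trans y x z : feq x y -> feq y z -> feq x z
| feq_opp x x' : feq x x' -> feq (FOpp x) (FOpp x')
| feq_add x x' y y' : feq x x' -> feq y y' -> feq (FAdd x y) (FAdd x' y')
| feq_mul x x' y y' : feq x x' -> feq y y' -> feq (FMul x y) (FMul x' y')
| feq_addA x y z : feq (FAdd x (FAdd y z)) (FAdd (FAdd x y) z)
| feq_addC x y : feq (FAdd x y) (FAdd y x)
| feq_add0 x : feq (FAdd (FConst 0) x) x
| feq_addN x : feq (FAdd (FOpp x) x) (FConst 0)
| feq_mulA x y z : feq (FMul x (FMul y z)) (FMul (FMul x y) z)
| feq_mul1l x : feq (FMul (FConst 1) x) x
| feq_mul1r x : feq (FMul x (FConst 1)) x
| feq_mulDl x y z : feq (FMul (FAdd x y) z) (FAdd (FMul x z) (FMul y z))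
| feq_mulDr x y z : feq (FMul x (FAdd y z)) (FAdd (FMul x y) (FMul x z))
| feq_constD a b : feq (FConst (a + b)) (FAdd (FConst a) (FConst b))
| feq_constM a b : feq (FConst (a * b)) (FMul (FConst a) (FConst b))
| feq_frob a : feq (FMul FVar (FConst a)) (FMul (FConst (a ^+ p)) FVar).

HB.instance Definition _ := gen_eqMixin fterm.
HB.instance Definition _ := gen_choiceMixin fterm.

Definition feqb (x y : fterm) : bool := `[< feq x y >].

Lemma feqb_refl : reflexive feqb.
Proof. by move=> x; apply/asboolP/feq_refl. Qed.
Lemma feqb_sym : symmetric feqb.
Proof. by move=> x y; apply/asboolP/asboolP; apply: feq_sym. Qed.
Lemma feqb_trans : transitive feqb.
Proof. by move=> y x z /asboolP xy /asboolP yz; apply/asboolP/(feq_trans xy). Qed.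

Canonical feq_equiv := EquivRel feqb feqb_refl feqb_sym feqb_trans.

Definition frobring : Type := {eq_quot feqb}.
HB.instance Definition _ := Choice.on frobring.
HB.instance Definition _ := Quotient.on frobring.

Definition fclass (x : fterm) : frobring := \pi_frobring x.
Definition fconst (a : R) : frobring := fclass (FConst a).
Definition fvar : frobring := fclass FVar.

Lemma fclassP x y : fclass x = fclass y <-> feq x y.
Proof.
by split=> [/(@eqmodP _ feq_equiv)/asboolP|xy] //; apply/(@eqmodP _ feq_equiv)/asboolP.
Qed.

Lemma fclassK (q : frobring) : fclass (repr q) = q.
Proof. exact: reprK. Qed.

Lemma repr_fclass x : feq (repr (fclass x)) x.
Proof. by apply/fclassP; rewrite fclassK. Qed.

Let opp (q : frobring) : frobring := fclass (FOpp (repr q)).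
Let add (q r : frobring) : frobring := fclass (FAdd (repr q) (repr r)).
Let mul (q r : frobring) : frobring := fclass (FMul (repr q) (repr r)).

Let oppE x : opp (fclass x) = fclass (FOpp x).
Proof. by apply/fclassP/feq_opp/repr_fclass. Qed.
Let addE x y : add (fclass x) (fclass y) = fclass (FAdd x y).
Proof. by apply/fclassP/feq_add; apply: repr_fclass. Qed.
Let mulE x y : mul (fclass x) (fclass y) = fclass (FMul x y).
Proof. by apply/fclassP/feq_mul; apply: repr_fclass. Qed.

Let addA : associative add.
Proof.
move=> x y z; rewrite -(fclassK x) -(fclassK y) -(fclassK z) !addE.
exact/fclassP/feq_addA.
Qed.
Let addC : commutative add.
Proof.
by move=> x y; rewrite -(fclassK x) -(fclassK y) !addE; apply/fclassP/feq_addC.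
Qed.
Let add0 : left_id (fconst 0) add.
Proof. by move=> x; rewrite -(fclassK x) addE; apply/fclassP/feq_add0. Qed.
Let addN : left_inverse (fconst 0) opp add.
Proof. by move=> x; rewrite -(fclassK x) oppE addE; apply/fclassP/feq_addN. Qed.

HB.instance Definition _ :=
  GRing.isZmodule.Build frobring addA addC add0 addN.

Let mulA : associative mul.
Proof.
move=> x y z; rewrite -(fclassK x) -(fclassK y) -(fclassK z) !mulE.
exact/fclassP/feq_mulA.
Qed.
Let mul1l : left_id (fconst 1) mul.
Proof. by move=> x; rewrite -(fclassK x) mulE; apply/fclassP/feq_mul1l. Qed.
Let mul1r : right_id (fconst 1) mul.
Proof. by move=> x; rewrite -(fclassK x) mulE; apply/fclassP/feq_mul1r. Qed.
Let mulDl : left_distributive mul +%R.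
Proof.
move=> x y z; rewrite -![_ + _]/(add _ _).
rewrite -(fclassK x) -(fclassK y) -(fclassK z) addE !mulE addE.
exact/fclassP/feq_mulDl.
Qed.
Let mulDr : right_distributive mul +%R.
Proof.
move=> x y z; rewrite -![_ + _]/(add _ _).
rewrite -(fclassK x) -(fclassK y) -(fclassK z) addE !mulE addE.
exact/fclassP/feq_mulDr.
Qed.

HB.instance Definition _ :=
  GRing.Zmodule_isPzRing.Build frobring mulA mul1l mul1r mulDl mulDr.

Lemma fclassN x : fclass (FOpp x) = - fclass x. Proof. exact/esym/oppE. Qed.
Lemma fclassD x y : fclass (FAdd x y) = fclass x + fclass y.
Proof. exact/esym/addE. Qed.
Lemma fclassM x y : fclass (FMul x y) = fclass x * fclass y.
Proof. exact/esym/mulE. Qed.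

Let fconstD a b : fconst (a + b) = fconst a + fconst b.
Proof. by rewrite -fclassD; apply/fclassP/feq_constD. Qed.
Let fconstM a b : fconst (a * b) = fconst a * fconst b.
Proof. by rewrite -fclassM; apply/fclassP/feq_constM. Qed.

Lemma fvar_const a : fvar * fconst a = fconst (a ^+ p) * fvar.
Proof. by rewrite -!fclassM; apply/fclassP/feq_frob. Qed.

Let fconst_is_zmod : zmod_morphism fconst.
Proof.
by move=> a b; apply/eqP; rewrite eq_sym subr_eq -fconstD subrK.
Qed.
Let fconst_is_monoid : monoid_morphism fconst.
Proof. by split=> //; apply: fconstM. Qed.

HB.instance Definition _ :=
  GRing.isZmodMorphism.Build R frobring fconst fconst_is_zmod.
HB.instance Definition _ :=
  GRing.isMonoidMorphism.Build R frobring fconst fconst_is_monoid.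

Definition base_module (M : lmodType frobring) : lmodType R := restrict fconst M.

End TwistedRing.

Section Unit.
Variables (R : comPzRingType) (p : nat) (p_prime : prime p).
Variable p0 : p%:R = 0 :> R.
Let phi : {rmorphism R -> R} := frobenius p_prime p0.

Section Action.
Variable M : lmodType (frobring R p).

(* F : M -> phi_* M *)
Definition F_action_fun (m : base_module M) : restrict phi (base_module M) :=
  fvar R p *: (m : M).

Let F_action_is_linear : linear F_action_fun.
Proof.
move=> a m n; rewrite /F_action_fun scalerDr; congr (_ + _).
by rewrite -[a *: m]/(fconst p a *: (m : M)) scalerA fvar_const -scalerA.
Qed.

HB.instance Definition _ :=
  GRing.isLinear.Build R (base_module M) (restrict phi (base_module M)) *:%R
    F_action_fun F_action_is_linear.

Definition F_action : {linear base_module M -> restrict phi (base_module M)} :=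
  F_action_fun.

End Action.

Definition is_unit_module (M : lmodType (frobring R p)) : Prop :=
  bijective (adjoint (F_action M)).

Definition unit_category : category :=
  @full_subcategory (module_category (frobring R p)) is_unit_module.

End Unit.

(* Main.v *)
Require Import Defs.
From Stdlib Require Import Relation_Operators.
From HB Require Import structures.
From mathcomp Require Import all_boot all_order all_algebra.
From mathcomp Require Import generic_quotient boolp.
Import Defs.

Set Implicit Arguments.
Unset Strict Implicit.
Unset Printing Implicit Defensive.

Import GRing.Theory.
Local Open Scope ring_scope.
Local Open Scope quotient_scope.

(** Every unit module X is a quotient of a unit module that is free over R:   *)
(** if P -> X is a free cover, Schanuel's trick makes P * P -> P -> X         *)
(** compatible with F up to an automorphism of P * P. If the unit module Q is *)
(** projective over R, then an extension of Q by a unit module K is given by  *)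
(** a Frobenius-semilinear map Q -> K; such maps lift along surjections       *)
(** M -> K, so Ext^1(Q, -) is right exact and Yoneda extensions of Q of       *)
(** length >= 2 are trivial. Replacing d middle terms of a unit extension of  *)
(** length > d + 1 by such covers leaves a syzygy that is projective over R,  *)
(** because R has global dimension d.                                         *)

(** Unit modules [Q] that are projective over [R] play the part of projective objects. An extension
    of such a [Q] by a unit module [K] splits over [R], so on it [F (m, x) = (F m + d x, F x)] for a
    Frobenius-semilinear [d : Q -> K]. Conversely every [d] occurs, because unit modules are closed
    under extensions ([unit_extension]). Since [d] lifts along surjections onto [K]
    ([projective_lifting]), [Ext^1(Q, -)] preserves surjections, and this forces [Ext^i(Q, -) = 0]
    for [i >= 2] ([lifting_trivial]). That [Ext^1] may survive accounts for the extra 1 in the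
    bound.

    Every unit module is a quotient of such a [Q] ([unit_free_cover]), and flatness of Frobenius
    makes the kernel a unit module again ([unit_kernel]). Induction on the projective dimension over
    [R] ([pd_le_trivial]), with dimension shifting by [effaceable_trivial], trivializes all
    extensions of length at least [d + 2].

    It remains to bound projective dimension over [R] by the vanishing of Yoneda Ext
    ([Ext_vanishes_pd_le]). Comparing a projective resolution with an extension gives a map out of
    the last syzygy, which depends only on the Yoneda class up to maps extending to the last
    projective term ([yoneda_invariant]). When Ext vanishes, the inclusion of that syzygy therefore
    splits. *)

Definition mklin (R : pzRingType) (U V : lmodType R) (f : U -> V)
  (fL : linear f) : {linear U -> V} := HB.pack f (GRing.isLinear.Build _ _ _ _ f fL).

(** * Kernels, cokernels and free modules *)

Section Kernel.
Variables (R : pzRingType) (M N : lmodType R) (f : {linear M -> N}).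

Definition kerp : {pred M} := fun m => f m == 0.
Lemma kerp_submod : submod_closed kerp.
Proof.
split=> [|a x y]; rewrite !unfold_in /kerp ?linear0 // => /eqP fx /eqP fy.
by rewrite linearP fx fy scaler0 addr0.
Qed.
HB.instance Definition _ := GRing.isSubmodClosed.Build R M kerp kerp_submod.

Record ker_type := Ker { ker_val :> M; _ : kerp ker_val }.
HB.instance Definition _ := [isSub for ker_val].
HB.instance Definition _ := [Choice of ker_type by <:].
HB.instance Definition _ := [SubChoice_isSubZmodule of ker_type by <:].
HB.instance Definition _ := [SubZmodule_isSubLmodule of ker_type by <:].

Definition ker_inc : {linear ker_type -> M} := (val : ker_type -> M).

Lemma ker_inc_inj : injective ker_inc. Proof. exact: val_inj. Qed.

Lemma ker_incP : exact_at ker_inc f.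
Proof.
move=> m; split=> [fm|[k <-]]; last by apply/eqP; case: k.
have km : kerp m by apply/eqP.
by exists (Ker km).
Qed.
End Kernel.

Section Cokernel.
Variables (R : pzRingType) (M N : lmodType R) (f : {linear M -> N}).

Definition coker_rel (x y : N) : bool := `[< exists m, f m = x - y >].
Lemma coker_rel_refl : reflexive coker_rel.
Proof. by move=> x; apply/asboolP; exists 0; rewrite linear0 subrr. Qed.
Lemma coker_rel_sym : symmetric coker_rel.
Proof.
by move=> x y; apply/asboolP/asboolP=> -[m fm]; exists (- m); rewrite linearN fm opprB.
Qed.
Lemma coker_rel_trans : transitive coker_rel.
Proof.
move=> y x z /asboolP[m fm] /asboolP[n fn]; apply/asboolP; exists (m + n).
by rewrite linearD fm fn addrA subrK.
Qed.
Canonical coker_equiv :=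
  EquivRel coker_rel coker_rel_refl coker_rel_sym coker_rel_trans.

Definition coker_type : Type := {eq_quot coker_rel}.
HB.instance Definition _ := Choice.on coker_type.
HB.instance Definition _ := Quotient.on coker_type.

Definition coker_class (x : N) : coker_type := \pi_coker_type x.

Lemma coker_classP x y : coker_class x = coker_class y <-> exists m, f m = x - y.
Proof.
by split=> [/(@eqmodP _ coker_equiv)/asboolP|xy] //;
  apply/(@eqmodP _ coker_equiv)/asboolP.
Qed.
Lemma coker_classK q : coker_class (repr q) = q. Proof. exact: reprK. Qed.
Lemma repr_coker_class x : exists m, f m = repr (coker_class x) - x.
Proof. by apply/coker_classP; rewrite coker_classK. Qed.

Let opp (q : coker_type) := coker_class (- repr q).
Let add (q r : coker_type) := coker_class (repr q + repr r).
Let scale (a : R) (q : coker_type) := coker_class (a *: repr q).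

Let oppE x : opp (coker_class x) = coker_class (- x).
Proof.
apply/coker_classP; have [m fm] := repr_coker_class x.
by exists (- m); rewrite linearN fm opprD.
Qed.
Let addE x y : add (coker_class x) (coker_class y) = coker_class (x + y).
Proof.
apply/coker_classP; have [m fm] := repr_coker_class x.
have [n fn] := repr_coker_class y.
by exists (m + n); rewrite linearD fm fn opprD addrACA.
Qed.
Let scaleE a x : scale a (coker_class x) = coker_class (a *: x).
Proof.
apply/coker_classP; have [m fm] := repr_coker_class x.
by exists (a *: m); rewrite linearZ /= fm scalerBr.
Qed.
Let addA : associative add.
Proof.
move=> x y z; rewrite -(coker_classK x) -(coker_classK y) -(coker_classK z).
by rewrite !addE addrA.
Qed.
Let addC : commutative add.
Proof. by move=> x y; rewrite /add addrC. Qed.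
Let add0 : left_id (coker_class 0) add.
Proof. by move=> x; rewrite -(coker_classK x) addE add0r. Qed.
Let addN : left_inverse (coker_class 0) opp add.
Proof. by move=> x; rewrite -(coker_classK x) oppE addE addNr. Qed.
HB.instance Definition _ := GRing.isZmodule.Build coker_type addA addC add0 addN.

Let scaleA a b q : scale a (scale b q) = scale (a * b) q.
Proof. by rewrite -(coker_classK q) !scaleE scalerA. Qed.
Let scale1 : left_id 1 scale.
Proof. by move=> q; rewrite -(coker_classK q) scaleE scale1r. Qed.
Let scaleDr : right_distributive scale +%R.
Proof.
move=> a q r; rewrite -![_ + _]/(add _ _) -(coker_classK q) -(coker_classK r).
by rewrite !(addE, scaleE) scalerDr.
Qed.
Let scaleDl q : {morph scale^~ q : a b / a + b}.
Proof.
move=> a b; rewrite -[RHS]/(add _ _) -(coker_classK q).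
by rewrite !(addE, scaleE) scalerDl.
Qed.
HB.instance Definition _ :=
  GRing.Zmodule_isLmodule.Build R coker_type scaleA scale1 scaleDr scaleDl.

Lemma coker_class_linear : linear coker_class.
Proof.
move=> a x y; rewrite -[RHS]/(add (scale _ _) _).
by rewrite scaleE addE.
Qed.
Definition coker_prj : {linear N -> coker_type} := mklin coker_class_linear.

Lemma coker_prj_surj q : exists x, coker_prj x = q.
Proof. by exists (repr q); apply: coker_classK. Qed.

Lemma coker_prjP : exact_at f coker_prj.
Proof.
move=> x; split=> [/coker_classP[m fm]|[m <-]]; first by exists m; rewrite fm subr0.
by apply/coker_classP; exists m; rewrite subr0.
Qed.
End Cokernel.

Section Free.
Variables (R : pzRingType) (S : Type).

Inductive free_term : Type :=
| FreeGen of S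
| FreeZero
| FreeOpp of free_term
| FreeAdd of free_term & free_term
| FreeScale of R & free_term.

Fixpoint free_eval (N : lmodType R) (g : S -> N) (x : free_term) : N :=
  match x with
  | FreeGen s => g s
  | FreeZero => 0
  | FreeOpp x => - free_eval g x
  | FreeAdd x y => free_eval g x + free_eval g y
  | FreeScale a x => a *: free_eval g x
  end.

Inductive free_eq : free_term -> free_term -> Prop :=
| free_eq_refl x : free_eq x x
| free_eq_sym x y : free_eq x y -> free_eq y x
| free_eq_trans y x z : free_eq x y -> free_eq y z -> free_eq x z
| free_eq_opp x x' : free_eq x x' -> free_eq (FreeOpp x) (FreeOpp x')
| free_eq_add x x' y y' :
    free_eq x x' -> free_eq y y' -> free_eq (FreeAdd x y) (FreeAdd x' y')
| free_eq_scale a x x' : free_eq x x' -> free_eq (FreeScale a x) (FreeScale a x')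
| free_eq_addA x y z :
    free_eq (FreeAdd x (FreeAdd y z)) (FreeAdd (FreeAdd x y) z)
| free_eq_addC x y : free_eq (FreeAdd x y) (FreeAdd y x)
| free_eq_add0 x : free_eq (FreeAdd FreeZero x) x
| free_eq_addN x : free_eq (FreeAdd (FreeOpp x) x) FreeZero
| free_eq_scaleA a b x :
    free_eq (FreeScale a (FreeScale b x)) (FreeScale (a * b) x)
| free_eq_scale1 x : free_eq (FreeScale 1 x) x
| free_eq_scaleDr a x y :
    free_eq (FreeScale a (FreeAdd x y)) (FreeAdd (FreeScale a x) (FreeScale a y))
| free_eq_scaleDl a b x :
    free_eq (FreeScale (a + b) x) (FreeAdd (FreeScale a x) (FreeScale b x)).

Lemma free_eval_eq (N : lmodType R) (g : S -> N) x y :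
  free_eq x y -> free_eval g x = free_eval g y.
Proof.
elim=> //= {x y}.
- by move=> y x z _ -> _ ->.
- by move=> x x' _ ->.
- by move=> x x' y y' _ -> _ ->.
- by move=> a x x' _ ->.
- by move=> x y z; rewrite addrA.
- by move=> x y; rewrite addrC.
- by move=> x; rewrite add0r.
- by move=> x; rewrite addNr.
- by move=> a b x; rewrite scalerA.
- by move=> x; rewrite scale1r.
- by move=> a x y; rewrite scalerDr.
- by move=> a b x; rewrite scalerDl.
Qed.

HB.instance Definition _ := gen_eqMixin free_term.
HB.instance Definition _ := gen_choiceMixin free_term.

Definition free_eqb (x y : free_term) : bool := `[< free_eq x y >].
Lemma free_eqb_refl : reflexive free_eqb.
Proof. by move=> x; apply/asboolP/free_eq_refl. Qed.
Lemma free_eqb_sym : symmetric free_eqb.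
Proof. by move=> x y; apply/asboolP/asboolP; apply: free_eq_sym. Qed.
Lemma free_eqb_trans : transitive free_eqb.
Proof.
by move=> y x z /asboolP xy /asboolP yz; apply/asboolP/(free_eq_trans xy).
Qed.
Canonical free_equiv := EquivRel free_eqb free_eqb_refl free_eqb_sym free_eqb_trans.

Definition free_module : Type := {eq_quot free_eqb}.
HB.instance Definition _ := Choice.on free_module.
HB.instance Definition _ := Quotient.on free_module.

Definition free_class (x : free_term) : free_module := \pi_free_module x.

Lemma free_classP x y : free_class x = free_class y <-> free_eq x y.
Proof.
by split=> [/(@eqmodP _ free_equiv)/asboolP|xy] //;
  apply/(@eqmodP _ free_equiv)/asboolP.
Qed.
Lemma free_classK q : free_class (repr q) = q. Proof. exact: reprK. Qed.
Lemma repr_free_class x : free_eq (repr (free_class x)) x.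
Proof. by apply/free_classP; rewrite free_classK. Qed.

Let zero : free_module := free_class FreeZero.
Let opp (q : free_module) := free_class (FreeOpp (repr q)).
Let add (q r : free_module) := free_class (FreeAdd (repr q) (repr r)).
Let scale a (q : free_module) := free_class (FreeScale a (repr q)).

Let oppE x : opp (free_class x) = free_class (FreeOpp x).
Proof. exact/free_classP/free_eq_opp/repr_free_class. Qed.
Let addE x y : add (free_class x) (free_class y) = free_class (FreeAdd x y).
Proof. by apply/free_classP/free_eq_add; apply: repr_free_class. Qed.
Let scaleE a x : scale a (free_class x) = free_class (FreeScale a x).
Proof. exact/free_classP/free_eq_scale/repr_free_class. Qed.
Let addA : associative add.
Proof.
move=> x y z; rewrite -(free_classK x) -(free_classK y) -(free_classK z) !addE.
exact/free_classP/free_eq_addA.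
Qed.
Let addC : commutative add.
Proof.
move=> x y; rewrite -(free_classK x) -(free_classK y) !addE.
exact/free_classP/free_eq_addC.
Qed.
Let add0 : left_id zero add.
Proof. by move=> x; rewrite -(free_classK x) addE; apply/free_classP/free_eq_add0. Qed.
Let addN : left_inverse zero opp add.
Proof.
by move=> x; rewrite -(free_classK x) oppE addE; apply/free_classP/free_eq_addN.
Qed.
HB.instance Definition _ := GRing.isZmodule.Build free_module addA addC add0 addN.

Let scaleA a b q : scale a (scale b q) = scale (a * b) q.
Proof.
by rewrite -(free_classK q) !scaleE; apply/free_classP/free_eq_scaleA.
Qed.
Let scale1 : left_id 1 scale.
Proof.
by move=> q; rewrite -(free_classK q) scaleE; apply/free_classP/free_eq_scale1.
Qed.
Let scaleDr : right_distributive scale +%R.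
Proof.
move=> a q r; rewrite -![_ + _]/(add _ _) -(free_classK q) -(free_classK r).
by rewrite !(addE, scaleE); apply/free_classP/free_eq_scaleDr.
Qed.
Let scaleDl q : {morph scale^~ q : a b / a + b}.
Proof.
move=> a b; rewrite -[RHS]/(add _ _) -(free_classK q).
by rewrite !(addE, scaleE); apply/free_classP/free_eq_scaleDl.
Qed.
HB.instance Definition _ :=
  GRing.Zmodule_isLmodule.Build R free_module scaleA scale1 scaleDr scaleDl.

Definition gen (s : S) : free_module := free_class (FreeGen s).

Lemma free_ind (P : free_module -> Prop) :
  (forall s, P (gen s)) -> P 0 -> (forall q, P q -> P (- q)) ->
  (forall q r, P q -> P r -> P (q + r)) -> (forall a q, P q -> P (a *: q)) ->
  forall q, P q.
Proof.
move=> Pg P0 PN PD PZ q; rewrite -(free_classK q); elim: (repr q) => //=.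
- by move=> x Px; rewrite -oppE; apply: PN.
- by move=> x Px y Py; rewrite -addE; apply: PD.
- by move=> a x Px; rewrite -scaleE; apply: PZ.
Qed.

Lemma free_lin_ext (N : lmodType R) (g h : {linear free_module -> N}) :
  (forall s, g (gen s) = h (gen s)) -> g =1 h.
Proof.
move=> gh; apply: free_ind => //.
- by rewrite !linear0.
- by move=> q IH; rewrite !linearN IH.
- by move=> q r IHq IHr; rewrite !linearD IHq IHr.
- by move=> a q IH; rewrite !linearZ /= IH.
Qed.

Section Lift.
Variables (N : lmodType R) (g : S -> N).

Definition free_lift_fun (q : free_module) : N := free_eval g (repr q).

Lemma free_lift_class x : free_lift_fun (free_class x) = free_eval g x.
Proof. exact/free_eval_eq/repr_free_class. Qed.

Lemma free_lift_linear : linear free_lift_fun.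
Proof.
move=> a q r; rewrite -[X in free_lift_fun X]/(add (scale a q) r).
rewrite -(free_classK q) -(free_classK r) scaleE addE.
by rewrite !free_lift_class.
Qed.

Definition free_lift : {linear free_module -> N} := mklin free_lift_linear.

Lemma free_lift_gen s : free_lift (gen s) = g s.
Proof. exact: free_lift_class. Qed.

Lemma free_lift_exists : exists h : {linear free_module -> N}, forall s, h (gen s) = g s.
Proof. by exists free_lift => s; apply: free_lift_gen. Qed.
End Lift.
End Free.

Definition surj (A B : Type) (f : A -> B) : Prop := forall y, exists x, f x = y.

(** * Projective modules and factorization through kernels and cokernels *)

Section Projective.
Variable R : pzRingType.
Implicit Types K L M N P V W : lmodType R.

Definition projective P : Prop :=
  forall M N (g : {linear M -> N}) (f : {linear P -> N}), surj g ->
    exists h : {linear P -> M}, forall x, g (h x) = f x.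

Lemma free_projective S : projective (free_module R S).
Proof.
move=> M N g f gs.
have [c cP] := choice (fun s : S => gs (f (gen R s))).
exists (free_lift c); apply: (@free_lin_ext _ _ _ (g \o free_lift c) f) => s.
by rewrite -[RHS]cP -(free_lift_gen c).
Qed.

Lemma free_cover M : surj (free_lift (id : M -> M)).
Proof. by move=> m; exists (gen R m); rewrite free_lift_gen. Qed.

Lemma lift_kernel K M N L (i : {linear K -> M}) (f : {linear M -> N})
    (u : {linear L -> M}) :
  injective i -> exact_at i f -> (forall x, f (u x) = 0) ->
  exists v : {linear L -> K}, forall x, i (v x) = u x.
Proof.
move=> i_inj iP fu.
have [v vP] := choice (fun x => (iP (u x)).1 (fu x)).
have vL : linear v.
  by move=> a x y; apply: i_inj; rewrite linearP !vP linearP.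
by exists (mklin vL).
Qed.

Lemma lift_cokernel L M N V (f : {linear L -> M}) (q : {linear M -> N})
    (u : {linear M -> V}) :
  surj q -> exact_at f q -> (forall x, u (f x) = 0) ->
  exists v : {linear N -> V}, forall x, v (q x) = u x.
Proof.
move=> q_surj qP uf.
have [s sP] := choice q_surj.
have us x y : q x = q y -> u x = u y.
  move=> qxy; apply/eqP; rewrite -subr_eq0 -linearB; apply/eqP.
  have /qP[l <-] : q (x - y) = 0 by rewrite linearB qxy subrr.
  exact: uf.
have vL : linear (u \o s).
  move=> a x y /=; rewrite -linearP; apply: us.
  by rewrite linearP !sP.
by exists (mklin vL) => x; apply: us; rewrite sP.
Qed.

(** A lift [h] of [f \o q] is corrected to [h - h i r], which vanishes on the image of [i] and so
    descends along [q]. The correction disappears after [g] because [q i = 0]. *)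
Lemma split_projective L M N (i : {linear L -> M}) (q : {linear M -> N})
    (r : {linear M -> L}) :
  projective M -> surj q -> exact_at i q -> (forall x, r (i x) = x) ->
  projective N.
Proof.
move=> M_proj q_surj iq ri V W g f g_surj.
have [h hP] := M_proj _ _ g (f \o q) g_surj.
have [h' h'P] : exists h' : {linear N -> V}, forall x, h' (q x) = h x - h (i (r x)).
  apply: (@lift_cokernel _ _ _ _ i q (h \- (h \o (i \o r)))) => // x /=.
  by rewrite ri subrr.
exists h' => y; have [x <-] := q_surj y; rewrite h'P linearB !hP /=.
have -> : q (i (r x)) = 0 by apply/iq; exists (r x).
by rewrite linear0 subr0.
Qed.

Lemma prod_projective M N : projective M -> projective N -> projective (M * N)%type.
Proof.
move=> Mp Np V W g f gs.
have i1L : linear (fun m : M => (m, 0 : N)).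
  by move=> a x y; congr (_, _) => /=; rewrite scaler0 addr0.
have i2L : linear (fun n : N => (0 : M, n)).
  by move=> a x y; congr (_, _) => /=; rewrite scaler0 addr0.
have [h1 h1P] := Mp _ _ g (f \o mklin i1L) gs.
have [h2 h2P] := Np _ _ g (f \o mklin i2L) gs.
exists ((h1 \o fst) \+ (h2 \o snd)) => -[x y] /=.
rewrite linearD h1P h2P -[LHS](linearD f) /=; congr (f _); congr (_, _) => /=.
  by rewrite addr0.
by rewrite add0r.
Qed.
End Projective.

(** * Yoneda extensions and projective resolutions *)

(* module_category S and unit_category are convertible to instances of this    *)
(* construction, which lets Yoneda extensions be treated once for both.        *)
Definition concrete (S : pzRingType) (O : Type) (u : O -> lmodType S) : category :=
  @Category O (fun X Y => @hom (module_category S) (u X) (u Y))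
    (fun X => @idm (module_category S) (u X))
    (fun X Y Z f g => @comp (module_category S) (u X) (u Y) (u Z) f g)
    (fun X Y f => @comp_idl (module_category S) (u X) (u Y) f)
    (fun X Y f => @comp_idr (module_category S) (u X) (u Y) f)
    (fun X Y Z W f g h =>
       @compA (module_category S) (u X) (u Y) (u Z) (u W) f g h).

Lemma concrete_full (S : pzRingType) (P : lmodType S -> Prop) :
  @full_subcategory (module_category S) P = @concrete S {M | P M} sval.
Proof. by []. Qed.

Section Concrete.
Variables (S : pzRingType) (O : Type) (u : O -> lmodType S).
Notation C := (concrete u).
Implicit Types X Y Z K : O.

Definition has_zero : Prop := exists Z, forall x : u Z, x = 0.
Definition has_kernels : Prop := forall X Y (f : {linear u X -> u Y}),
  exists K (i : {linear u K -> u X}), injective i /\ exact_at i f.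
Definition has_cokernels : Prop := forall X Y (f : {linear u X -> u Y}),
  exists Q (q : {linear u Y -> u Q}), surj q /\ exact_at f q.
Definition has_products : Prop := forall X Y,
  exists W (g : {linear u W -> (u X * u Y)%type}), injective g /\ surj g.

Hypothesis u_zero : has_zero.

(** On a zero object the identity equals the zero endomorphism, so a map through it vanishes
    pointwise. Conversely, the object given by [u_zero] is a zero object of the category. *)
Lemma zero_morphismP X Y (f : {linear u X -> u Y}) :
  @zero_morphism C X Y f <-> forall x, f x = 0.
Proof.
split=> [[Z [v [w [Zz ->]]]] x /=|f0].
  have [_ [v' [_ vu]]] := Zz Z.
  have := vu (\0 : {linear u Z -> u Z}) I.
  rewrite (vu (@idm C Z) I) => E.
  have -> : (v : {linear u X -> u Z}) x = 0.
    by have /(congr1 (fun h : {linear u Z -> u Z} => h ((v : {linear u X -> u Z}) x))) := E.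
  exact: linear0.
have [Z Z0] := u_zero.
exists Z, (\0 : {linear u X -> u Z}), (\0 : {linear u Z -> u Y}); split.
  move=> T; split.
    exists (\0 : {linear u T -> u Z}); split=> // g _.
    by apply: linear_ext => x; rewrite /= [RHS]Z0.
  exists (\0 : {linear u Z -> u T}); split=> // g _.
  by apply: linear_ext => x; rewrite /= (Z0 x) linear0.
by apply: linear_ext => x; rewrite f0.
Qed.

Lemma exact_kernel K X Y (i : {linear u K -> u X}) (f : {linear u X -> u Y}) :
  injective i -> exact_at i f -> @is_kernel C K X Y i f.
Proof.
move=> i_inj iP; split=> [|T v /zero_morphismP fv].
  by apply/zero_morphismP => x /=; apply/iP; exists x.
have [w wP] := lift_kernel (u := v) i_inj iP fv.
exists w; split=> [|w' /(congr1 (fun h : {linear u T -> u X} => h : _ -> _)) iw'].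
  by apply: linear_ext => x /=; rewrite wP.
apply: linear_ext => x; apply: i_inj.
by rewrite wP -iw'.
Qed.

Lemma exact_cokernel X Y Q (q : {linear u Y -> u Q}) (f : {linear u X -> u Y}) :
  surj q -> exact_at f q -> @is_cokernel C X Y Q q f.
Proof.
move=> q_surj qP; split=> [|T v /zero_morphismP vf].
  by apply/zero_morphismP => x /=; apply/qP; exists x.
have [w wP] := lift_cokernel (u := v) q_surj qP vf.
exists w; split=> [|w' /(congr1 (fun h : {linear u Y -> u T} => h : _ -> _)) w'q].
  by apply: linear_ext => x /=; rewrite wP.
by apply: linear_ext => x; have [y <-] := q_surj x; rewrite wP -w'q.
Qed.

Definition make_ses X M Y (i : {linear u Y -> u M}) (q : {linear u M -> u X})
  (i_inj : injective i) (q_surj : surj q) (iq : exact_at i q) :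
    short_exact_sequence (C := C) X Y :=
  ShortExactSequence (exact_kernel i_inj iq) (exact_cokernel q_surj iq).

Section Ses.
Variables (X Y : O) (E : short_exact_sequence (C := C) X Y).
Definition mid : lmodType S := u (ses_mid E).
Definition inc : {linear u Y -> mid} := ses_inc E.
Definition prj : {linear mid -> u X} := ses_prj E.

Hypotheses (u_ker : has_kernels) (u_coker : has_cokernels).

(** Kernels are unique up to isomorphism, so [inc] is compared, through [v] and [w], with the
    module-theoretic kernel supplied by [u_ker]. *)
Lemma inc_exact : injective inc /\ exact_at inc prj.
Proof.
have [/zero_morphismP pi0 ku] := ses_kernel E.
have [K [i [i_inj iP]]] := u_ker prj.
have [|v' [vi _]] := ku K i.
  by apply/zero_morphismP => x /=; apply/iP; exists x.
pose v : {linear u K -> u Y} := v'.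
have vE x : inc (v x) = i x.
  by rewrite -[in RHS]vi.
have [w wE] := lift_kernel (u := inc) i_inj iP pi0.
have vwE x : v (w x) = x.
  have [|t [_ tu]] := ku Y inc; first exact/zero_morphismP.
  have -> : v (w x) = (t : {linear u Y -> u Y}) x.
    rewrite (tu (comp (c := C) v w)) //.
    by apply: linear_ext => y /=; rewrite -[LHS]/(inc _) vE wE.
  by rewrite (tu (@idm C Y)) //; apply: comp_idr.
split=> [x y xy|x].
  by rewrite -(vwE x) -(vwE y); congr (_ _); apply: i_inj; rewrite !wE.
split=> [/iP[k <-]|[y <-]]; last exact: pi0.
by exists (v k).
Qed.

(** If [q] is the module-theoretic cokernel of [prj], then [q] and 0 both factor the zero map
    through the categorical cokernel [prj], hence agree. *)
Lemma prj_surj : surj prj.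
Proof.
have [_ cu] := ses_cokernel E.
have [Q [q [q_surj qP]]] := u_coker prj.
have qp x : q (prj x) = 0 by apply/qP; exists x.
have [|t [_ tu]] := cu Q (\0 : {linear mid -> u Q}).
  by apply/zero_morphismP.
move=> y; apply/qP.
have tq : t = q.
  by apply: tu; apply: linear_ext => x /=; rewrite -[LHS]/(q (prj x)).
have t0 : t = (\0 : {linear u X -> u Q}).
  by apply: tu; apply: linear_ext.
by rewrite -tq t0.
Qed.
End Ses.

Lemma ses_morphismP X Y X' Y' (a : {linear u X -> u X'}) (b : {linear u Y -> u Y'})
    (E : short_exact_sequence (C := C) X Y)
    (E' : short_exact_sequence (C := C) X' Y') :
  @ses_morphism C X Y X' Y' a b E E' <->
  exists e : {linear mid E -> mid E'},
    (forall y, e (inc E y) = inc E' (b y)) /\ (forall x, prj E' (e x) = a (prj E x)).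
Proof.
split=> -[e [ei pe]]; exists e; split.
- move=> y; have /(congr1 (fun h : {linear _ -> _} => h y)) := ei; exact.
- move=> y; have /(congr1 (fun h : {linear _ -> _} => h y)) := pe; exact.
- exact: linear_ext.
- exact: linear_ext.
Qed.

Hypotheses (u_ker : has_kernels) (u_coker : has_cokernels) (u_prod : has_products).

Lemma ses_morphism_id X Y (E : short_exact_sequence (C := C) X Y) :
  @ses_morphism C _ _ _ _ (@idm C X) (@idm C Y) E E.
Proof. by exists (idm _); rewrite !comp_idl !comp_idr. Qed.

Lemma ses_morphism_comp (D : category) (X Y X' Y' X'' Y'' : D)
    (a : hom X X') (b : hom Y Y')
    (a' : hom X' X'') (b' : hom Y' Y'') E E' E'' :
  ses_morphism a b E E' -> ses_morphism a' b' E' E'' ->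
  ses_morphism (comp a' a) (comp b' b) E E''.
Proof.
move=> [e [ei pe]] [e' [ei' pe']]; exists (comp e' e); split.
  by rewrite -compA ei compA ei' compA.
by rewrite compA pe' -compA pe compA.
Qed.

Lemma product_ses X Y : exists E : short_exact_sequence (C := C) X Y,
  exists p : {linear mid E -> u Y}, forall y, p (inc E y) = y.
Proof.
have [W [g [g_inj g_surj]]] := u_prod X Y.
have g_ex : exact_at g (\0 : {linear (u X * u Y)%type -> (u X * u Y)%type}).
  by move=> x; split.
have jL : linear (fun y : u Y => (0 : u X, y)).
  by move=> a x y; congr (_, _) => /=; rewrite scaler0 addr0.
have [i iE] := lift_kernel (u := mklin jL) g_inj g_ex (fun=> erefl).
pose q : {linear u W -> u X} := fst \o g.
have i_inj : injective i by move=> x y xy; have := iE x; rewrite xy iE => -[].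
have q_surj : surj q.
  by move=> x; have [w gw] := g_surj (x, 0); exists w; rewrite /= gw.
have iq : exact_at i q.
  move=> w; split=> [/= gw0|[y <-]]; last by rewrite /= iE.
  exists (g w).2; apply: g_inj; rewrite iE /=.
  by move: gw0; case: (g w) => x y /= ->.
by exists (make_ses i_inj q_surj iq), (snd \o g) => y; rewrite /= iE.
Qed.

(* Projective resolutions of length n+1 are encoded as the (n+1)-extensions  *)
(* all of whose middle terms are projective.                                  *)
Fixpoint all_projective n X Y : @extension C n.+1 X Y -> Prop :=
  match n with
  | 0 => fun E => projective (mid E)
  | _.+1 => fun E => projective (mid (projT2 E).1) /\ all_projective (projT2 E).2
  end.

(** When [E] is all-projective, [Y] is a syzygy of [X], and [f] represents a class in
    [Ext^(n+1)(X, T)], computed as [Hom(Y, T)] modulo maps extending to the last middle term. The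
    predicate says that this class is 0. *)
Fixpoint extends n X Y T (f : {linear u Y -> u T}) : @extension C n.+1 X Y -> Prop :=
  match n with
  | 0 => fun E => exists r : {linear mid E -> u T}, forall y, r (inc E y) = f y
  | _.+1 => fun E => extends f (projT2 E).2
  end.

Fixpoint chain_map n X X' Y Y' (a : {linear u X -> u X'}) (f : {linear u Y -> u Y'}) :
    @extension C n.+1 X Y -> @extension C n.+1 X' Y' -> Prop :=
  match n with
  | 0 => fun E E' => @ses_morphism C _ _ _ _ a f E E'
  | _.+1 => fun E E' =>
      exists k : {linear u (projT1 E) -> u (projT1 E')},
        @ses_morphism C _ _ _ _ a k (projT2 E).1 (projT2 E').1 /\
        chain_map k f (projT2 E).2 (projT2 E').2
  end.

Lemma ses_comparison X Y X' Y' (E : short_exact_sequence (C := C) X Y)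
    (E' : short_exact_sequence (C := C) X' Y') (a : {linear u X -> u X'}) :
  projective (mid E) ->
  exists k : {linear u Y -> u Y'}, @ses_morphism C _ _ _ _ a k E E'.
Proof.
move=> /(_ _ _ (prj E') (a \o prj E) (prj_surj E' u_coker))[e eP].
have [E_inj E_ex] := inc_exact E u_ker; have [E'_inj E'_ex] := inc_exact E' u_ker.
have [k kP] : exists k : {linear u Y -> u Y'}, forall y, inc E' (k y) = e (inc E y).
  apply: (lift_kernel (u := e \o inc E) E'_inj E'_ex) => y /=.
  by rewrite eP /= (_ : prj E (inc E y) = 0) ?linear0 //; apply/E_ex; exists y.
by exists k; apply/ses_morphismP; exists e; split=> [y|x]; rewrite ?kP ?eP.
Qed.

Lemma comparison n X Y X' Y' (E : @extension C n.+1 X Y)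
    (E' : @extension C n.+1 X' Y') (a : {linear u X -> u X'}) :
  all_projective E -> exists f, chain_map a f E E'.
Proof.
elim: n X X' a E E' => [|n IH] X X' a E E' /=; first exact: ses_comparison.
case=> /(ses_comparison (projT2 E').1 a)[k kP] /(IH _ _ k _ (projT2 E').2)[f fP].
by exists f, k.
Qed.

Lemma chain_map_comp n X X' X'' Y Y' (a : {linear u X -> u X'})
    (f : {linear u Y -> u Y'}) (b : {linear u X' -> u X''})
    (E : @extension C n.+1 X Y) (E' : @extension C n.+1 X' Y')
    (E'' : @extension C n.+1 X'' Y') :
  chain_map a f E E' -> @extension_morphism C n.+1 X' X'' Y' b E' E'' ->
  chain_map (b \o a) f E E''.
Proof.
elim: n X X' X'' a b E E' E'' => [|n IH] X X' X'' a b E E' E'' /=.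
  move=> EE' E'E''; have := ses_morphism_comp EE' E'E''.
  by rewrite comp_idl.
move=> [k [EE' kf]] [l [E'E'' lm]]; exists (l \o k); split.
  exact: (ses_morphism_comp EE' E'E'').
exact: IH kf lm.
Qed.

(** One step of a chain homotopy. If [t] lifts [h] to [mid E'], then [e - e' - t j prj] lands in the
    kernel of [prj E'], hence in [Y'], and restricts to [k - l] on [Y]. *)
Lemma ses_homotopy X Y X' Y' (a b : {linear u X -> u X'}) (k l : {linear u Y -> u Y'})
    (E : short_exact_sequence (C := C) X Y) (E' : short_exact_sequence (C := C) X' Y')
    (Q : lmodType S) (j : {linear u X -> Q}) (h : {linear Q -> u X'}) :
  projective Q -> (forall x, a x - b x = h (j x)) ->
  @ses_morphism C _ _ _ _ a k E E' -> @ses_morphism C _ _ _ _ b l E E' ->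
  exists m : {linear mid E -> u Y'}, forall y, k y - l y = m (inc E y).
Proof.
move=> Q_proj ab /ses_morphismP[e [ei pe]] /ses_morphismP[e' [ei' pe']].
have [E_inj E_ex] := inc_exact E u_ker; have [E'_inj E'_ex] := inc_exact E' u_ker.
have [t tP] := Q_proj _ _ (prj E') h (prj_surj E' u_coker).
pose d : {linear mid E -> mid E'} := (e \- e') \- (t \o (j \o prj E)).
have [m mP] : exists m : {linear mid E -> u Y'}, forall x, inc E' (m x) = d x.
  apply: (lift_kernel E'_inj E'_ex) => x.
  by rewrite /d /= !linearB /= tP -ab pe pe' subrr.
exists m => y; apply: E'_inj; rewrite mP /d /= (_ : prj E (inc E y) = 0).
  by rewrite !linear0 addr0 linearB ei ei'.
by apply/E_ex; exists y.
Qed.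

(** The conclusion of [ses_homotopy] is its own hypothesis one step further along, with [mid E] as
    the projective module through which [k - l] factors. *)
Lemma homotopy n X Y X' Y' (a b : {linear u X -> u X'}) (f g : {linear u Y -> u Y'})
    (E : @extension C n.+1 X Y) (E' : @extension C n.+1 X' Y')
    (Q : lmodType S) (j : {linear u X -> Q}) (h : {linear Q -> u X'}) :
  all_projective E -> projective Q -> (forall x, a x - b x = h (j x)) ->
  chain_map a f E E' -> chain_map b g E E' -> extends (f \- g) E.
Proof.
elim: n X X' a b E E' Q j h => [|n IH] X X' a b E E' Q j h /=.
  move=> _ Qp ab fP gP; have [m mP] := ses_homotopy Qp ab fP gP.
  by exists m => y; rewrite -mP.
move=> [Ep E2p] Qp ab [k [kP kf]] [l [lP lg]].
have [m mP] := ses_homotopy Qp ab kP lP.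
exact: (IH _ _ _ _ _ _ _ _ _ E2p Ep mP kf lg).
Qed.

Lemma extendsD n X Y T (f g : {linear u Y -> u T}) (E : @extension C n.+1 X Y) :
  extends f E -> extends g E -> extends (f \+ g) E.
Proof.
elim: n X E => [|n IH] X E /=; last exact: IH.
by move=> [r rP] [s sP]; exists (r \+ s) => y; rewrite /= rP sP.
Qed.

Lemma extendsN n X Y T (f : {linear u Y -> u T}) (E : @extension C n.+1 X Y) :
  extends f E -> extends (\- f) E.
Proof.
elim: n X E => [|n IH] X E /=; last exact: IH.
by move=> [r rP]; exists (\- r) => y; rewrite /= rP.
Qed.

Lemma eq_extends n X Y T (f g : {linear u Y -> u T}) (E : @extension C n.+1 X Y) :
  f =1 g -> extends f E -> extends g E.
Proof. by move=> /linear_ext ->. Qed.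

Lemma yoneda_invariant n X Y Y' (R : @extension C n.+1 X Y)
    (E E' : @extension C n.+1 X Y') :
  all_projective R -> @yoneda_equivalent C n.+1 X Y' E E' ->
  forall f g, chain_map idfun f R E -> chain_map idfun g R E' -> extends (f \- g) R.
Proof.
move=> Rp.
have same F f g : chain_map idfun f R F -> chain_map idfun g R F -> extends (f \- g) R.
  (* Both maps cover [idfun], so the difference on the [X]-end is 0 and factors through the zero
     module, here the free module on no generators. *)
  move=> fP gP; pose Q : lmodType S := free_module S void.
  apply: (@homotopy _ _ _ _ _ idfun idfun f g R F Q
    (\0 : {linear u X -> Q}) (\0 : {linear Q -> u X}) Rp _ _ fP gP).
    exact: free_projective.
  by move=> x; rewrite /= subrr.
elim=> {E E'} [E E' EE'|E|E E' _ IH|E F E' _ IH1 _ IH2] f g fP gP.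
- apply: same gP.
  have <- : (idfun \o idfun : {linear u X -> u X}) = (idfun : {linear u X -> u X}).
    exact: linear_ext.
  exact: chain_map_comp fP EE'.
- exact: same gP.
- apply: eq_extends (extendsN (IH _ _ gP fP)) => x.
  by rewrite /= opprB.
(* Projectivity provides a comparison map to the intermediate extension, and the two differences add
   up. *)
- have [h hP] := comparison F (idfun : {linear u X -> u X}) Rp.
  apply: eq_extends (extendsD (IH1 _ _ fP hP) (IH2 _ _ hP gP)) => x.
  by rewrite /= addrA subrK.
Qed.

Lemma chain_map_id n X Y (E : @extension C n.+1 X Y) : chain_map idfun idfun E E.
Proof.
elim: n X E => [|n IH] X E /=; first exact: ses_morphism_id.
by exists idfun; split; [exact: ses_morphism_id | exact: IH].
Qed.

(** Only the last short exact sequence of [E] is changed, into a split one with the same ends. *)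
Lemma chain_map_split n X Y (E : @extension C n.+1 X Y) :
  exists E', chain_map idfun (\0 : {linear u Y -> u Y}) E E'.
Proof.
elim: n X E => [|n IH] X E /=.
  have [E' [p pP]] := product_ses X Y.
  have [E'_inj E'_ex] := inc_exact E' u_ker.
  have [_ E_ex] := inc_exact E u_ker.
  (* [d] kills the image of [inc E'] and so descends to a section [s] of [prj E']; then [s \o prj E]
     vanishes on [Y]. *)
  pose d : {linear mid E' -> mid E'} := idfun \- (inc E' \o p).
  have [s sP] : exists s : {linear u X -> mid E'}, forall x, s (prj E' x) = d x.
    apply: (lift_cokernel (prj_surj E' u_coker) E'_ex) => x.
    by rewrite /d /= pP subrr.
  exists E'; apply/ses_morphismP; exists (s \o prj E); split=> [y|x] /=.
    by rewrite linear0 (_ : prj E (inc E y) = 0) ?linear0 //; apply/E_ex; exists y.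
  have [x' <-] := prj_surj E' u_coker (prj E x).
  rewrite sP /d /= linearB /= (_ : prj E' (inc E' _) = 0) ?subr0 //.
  by apply/E'_ex; eexists.
have [E' E'P] := IH _ (projT2 E).2.
exists (existT _ (projT1 E) ((projT2 E).1, E')), idfun; split=> //.
exact: ses_morphism_id.
Qed.

(** [E] maps to itself by the identity on [Y], and to an equivalent extension by 0 on [Y]. The
    difference of these comparison maps is the identity, so the inclusion of the last syzygy has a
    retraction. *)
Lemma Ext_vanishes_split n X Y (E : @extension C n.+1 X Y) :
  @Ext_vanishes C n.+1 X Y -> all_projective E -> extends idfun E.
Proof.
move=> ext0 Ep; have [E' EE'] := chain_map_split E.
apply: eq_extends (yoneda_invariant Ep (ext0 E E') (chain_map_id E) EE') => x.
by rewrite /= subr0.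
Qed.

End Concrete.

(** * Projective dimension from the vanishing of Yoneda Ext *)

Section ProjectiveDimension.
Variable S : pzRingType.
Implicit Types K M N P X : lmodType S.
Notation C := (@concrete S (lmodType S) id).

(** The condition ranges over all projective presentations, so that it applies directly to the
    covers by unit modules chosen later. *)
Fixpoint pd_le n X : Prop :=
  match n with
  | 0 => projective X
  | n'.+1 => forall P K (q : {linear P -> X}) (i : {linear K -> P}),
      projective P -> surj q -> injective i -> exact_at i q -> pd_le n' K
  end.

Lemma module_has_zero : has_zero (@id (lmodType S)).
Proof.
exists (free_module S void); apply: (free_ind (P := fun x => x = 0)) => //.
- by move=> q ->; rewrite oppr0.
- by move=> q r -> ->; rewrite addr0.
- by move=> a q ->; rewrite scaler0.
Qed.
Lemma module_has_kernels : has_kernels (@id (lmodType S)).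
Proof.
move=> X Y f; exists (ker_type f), (ker_inc f).
by split; [exact: ker_inc_inj | exact: ker_incP].
Qed.
Lemma module_has_cokernels : has_cokernels (@id (lmodType S)).
Proof.
move=> X Y f; exists (coker_type f), (coker_prj f).
by split; [exact: coker_prj_surj | exact: coker_prjP].
Qed.
Lemma module_has_products : has_products (@id (lmodType S)).
Proof. by move=> X Y; exists (X * Y)%type, idfun; split=> // x; exists x. Qed.

Let z := module_has_zero.

(** At length 1, a retraction onto the kernel of a free cover makes [X] projective. At greater
    length, a presentation of [X] is spliced onto any projective extension of its kernel. *)
Lemma split_pd_le n X :
  (forall Y (E : @extension C n.+1 X Y),
    all_projective E -> @extends _ _ id _ _ _ Y idfun E) -> pd_le n X.
Proof.
elim: n X => [|n IH] X splitX /=.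
  pose q := free_lift (id : X -> X).
  pose E : short_exact_sequence (C := C) X (ker_type q) :=
    make_ses (u := id) z (@ker_inc_inj _ _ _ q) (@free_cover _ X) (@ker_incP _ _ _ q).
  have [|r rP] := splitX _ E; first exact: free_projective.
  exact: (@split_projective _ _ _ _ (ker_inc q) q r (@free_projective _ _)
    (@free_cover _ X) (@ker_incP _ _ _ q) rP).
move=> P K q i Pp q_surj i_inj iq; apply: IH => Y E Ep.
pose E1 : short_exact_sequence (C := C) X K := make_ses (u := id) z i_inj q_surj iq.
by apply: (splitX Y (existT _ K (E1, E))).
Qed.

Lemma Ext_vanishes_pd_le n X :
  (forall Y, @Ext_vanishes (module_category S) n.+1 X Y) -> pd_le n X.
Proof.
move=> ext0; apply: split_pd_le => Y E.
exact: (Ext_vanishes_split z module_has_kernels module_has_cokernels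
  module_has_products (ext0 Y)).
Qed.
End ProjectiveDimension.

(** * Criteria for the vanishing of Ext *)

Section Trivial.
Variables (S : pzRingType) (O : Type) (u : O -> lmodType S).
Notation C := (concrete u).
Implicit Types X Y K : O.

Hypotheses (u_zero : has_zero u) (u_ker : has_kernels u).
Hypotheses (u_coker : has_cokernels u) (u_prod : has_products u).
Variables (Z : O) (Z0 : forall x : u Z, x = 0).

Lemma extension_morphism_refl n X Y (E : @extension C n X Y) :
  extension_morphism (@idm C X) E E.
Proof.
case: n E => [|n] E; first exact: esym (@comp_idr C X Y E).
elim: n X E => [|n IH] X E; first exact: ses_morphism_id.
by exists (@idm C _); split; [exact: ses_morphism_id | exact: IH].
Qed.

Lemma yoneda_equivalent_splice n X Y K (E : @short_exact_sequence C X K)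
    (F F' : @extension C n.+1 K Y) :
  yoneda_equivalent F F' ->
  @yoneda_equivalent C n.+2 X Y (existT _ K (E, F)) (existT _ K (E, F')).
Proof.
elim=> {F F'} [F F' FF'|F|F F' _ IH|F G F' _ IH1 _ IH2].
- apply: rst_step; exists (@idm C K); split=> //.
  exact: ses_morphism_id.
- exact: rst_refl.
- exact: rst_sym.
- exact: rst_trans IH1 IH2.
Qed.

Lemma inc_prj X Y (E : short_exact_sequence (C := C) X Y) y : prj E (inc E y) = 0.
Proof. by have [_ iq] := inc_exact u_zero E u_ker; apply/iq; exists y. Qed.

Definition ses_left0 Y : short_exact_sequence (C := C) Z Y.
Proof.
apply: (@make_ses _ _ _ u_zero Z Y Y idfun \0) => //.
- by move=> z; exists 0; rewrite (Z0 z).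
- by move=> y; split=> // _; exists y.
Defined.

Definition ses_right0 X : short_exact_sequence (C := C) X Z.
Proof.
apply: (@make_ses _ _ _ u_zero X X Z \0 idfun) => //.
- by move=> x y _; rewrite (Z0 x) (Z0 y).
- by move=> x; exists x.
- by move=> x; split=> [x0|[_ <-] //]; exists 0; apply: esym.
Defined.

Fixpoint trivial0 n Y : @extension C n.+1 Z Y :=
  match n with
  | 0 => ses_left0 Y
  | n'.+1 => existT _ Z (ses_right0 Z, trivial0 n' Y)
  end.

(** The exact sequence with middle terms [Y, 0, ..., 0, X], identities at both ends and zero maps
    between. Length at least 2 is what leaves room for both [Y] and [X]. *)
Definition trivial_extension n X Y : @extension C n.+2 X Y :=
  existT _ Z (ses_right0 X, trivial0 n Y).

Lemma ses_right0_initial X Y (E : short_exact_sequence (C := C) X Y) :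
  @ses_morphism C _ _ _ _ (\0 : {linear u Z -> u X}) (\0 : {linear u Z -> u Y})
    (ses_right0 Z) E.
Proof.
apply/ses_morphismP; exists \0; split=> x /=; first by rewrite linear0.
exact: linear0.
Qed.

Lemma ses_right0_terminal X Y (E : short_exact_sequence (C := C) X Y) :
  @ses_morphism C _ _ _ _ (@idm C X) (\0 : {linear u Y -> u Z}) E (ses_right0 X).
Proof.
by apply/ses_morphismP; exists (prj E); split=> x //=; rewrite inc_prj.
Qed.

Lemma ses_left0_initial X Y (E : short_exact_sequence (C := C) X Y) :
  @ses_morphism C _ _ _ _ (\0 : {linear u Z -> u X}) (@idm C Y) (ses_left0 Y) E.
Proof.
by apply/ses_morphismP; exists (inc E); split=> x //=; rewrite inc_prj.
Qed.

Lemma trivial0_initial n X Y (E : @extension C n.+1 X Y) :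
  @extension_morphism C n.+1 Z X Y (\0 : {linear u Z -> u X}) (trivial0 n Y) E.
Proof.
elim: n X E => [|n IH] X E; first exact: ses_left0_initial.
exists (\0 : {linear u Z -> u (projT1 E)}); split; last exact: IH.
exact: ses_right0_initial.
Qed.

(** The middle term is the fibre product of [X'] and [mid E] over [X], cut out of the product as the
    kernel of [d]. *)
Lemma ses_pullback X X' Y (k : {linear u X' -> u X})
    (E : short_exact_sequence (C := C) X Y) :
  exists E' : short_exact_sequence (C := C) X' Y,
    @ses_morphism C _ _ _ _ k (@idm C Y) E' E.
Proof.
have [W [g [g_inj g_surj]]] := u_prod X' (ses_mid E).
have [E_inj E_ex] := inc_exact u_zero E u_ker.
pose d : {linear u W -> u X} := (k \o fst \o g) \- (prj E \o snd \o g).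
have [V [i [i_inj iP]]] := u_ker d.
have lift x m : k x = prj E m -> exists v, g (i v) = (x, m).
  move=> km; have [w gw] := g_surj (x, m).
  have /iP[v iv] : d w = 0 by rewrite /d /= gw /= km subrr.
  by exists v; rewrite iv.
have V_fib v : k (g (i v)).1 = prj E (g (i v)).2.
  by apply/eqP; rewrite -subr_eq0; apply/eqP/iP; exists v.
pose q : {linear u V -> u X'} := fst \o g \o i.
have jP y : exists v, g (i v) = (0, inc E y).
  by apply: lift; rewrite linear0 inc_prj.
have [j0 j0P] := choice jP.
have gi_inj : injective (g \o i) by move=> x y /g_inj /i_inj.
have jL : linear j0.
  move=> a x y; apply: gi_inj; rewrite /= j0P !linearP /= !j0P.
  by congr (_, _); rewrite /= scaler0 addr0.
pose j := mklin jL.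
have jE y : g (i (j y)) = (0, inc E y) := j0P y.
have j_inj : injective j.
  by move=> x y xy; apply: E_inj; have := jE x; rewrite xy jE => -[].
have q_surj : surj q.
  move=> x; have [m pm] := prj_surj u_zero E u_coker (k x).
  by have [v gv] := lift x m (esym pm); exists v; rewrite /= gv.
have jq : exact_at j q.
  move=> v; split=> [/= gv0|[y <-]]; last by rewrite /q /= jE.
  have /E_ex[y yE] : prj E (g (i v)).2 = 0 by rewrite -V_fib gv0 linear0.
  exists y; apply: gi_inj; rewrite /= jE yE.
  by move: gv0; case: (g (i v)) => x m /= ->.
exists (make_ses u_zero j_inj q_surj jq); apply/ses_morphismP.
by exists (snd \o g \o i); split=> x /=; rewrite ?jE ?V_fib.
Qed.

Lemma extension_pullback n X X' Y (k : {linear u X' -> u X})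
    (E : @extension C n.+1 X Y) :
  exists E' : @extension C n.+1 X' Y, @extension_morphism C n.+1 X' X Y k E' E.
Proof.
case: n E => [|n] E; first exact: ses_pullback.
have [E' EE'] := ses_pullback k (projT2 E).1.
exists (existT _ (projT1 E) (E', (projT2 E).2)), (@idm C _); split=> //.
exact: extension_morphism_refl.
Qed.

(** The pullback of a sequence along its own projection splits. The split sequence is therefore
    taken directly, mapping to [mid E] by [inc r + prj], while its retraction [r] gives the map to
    [ses_left0 Y]. *)
Lemma ses_pullback_prj X Y (E : short_exact_sequence (C := C) X Y) :
  exists E' : short_exact_sequence (C := C) (ses_mid E) Y,
    @ses_morphism C _ _ _ _ (prj E) (@idm C Y) E' E /\
    @ses_morphism C _ _ _ _ (\0 : {linear mid E -> u Z}) (@idm C Y) E' (ses_left0 Y).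
Proof.
have [E' [r rP]] := product_ses u_zero u_prod (ses_mid E) Y.
exists E'; split; apply/ses_morphismP.
  exists ((inc E \o r) \+ prj E'); split=> x /=.
    by rewrite rP inc_prj addr0.
  by rewrite linearD /= inc_prj add0r.
by exists r; split=> x //=; rewrite rP.
Qed.

(** Every extension dies after pullback along some surjection [g]. That it dies is recorded by a
    second morphism out of [E'], to an extension of the zero object. *)
Lemma extension_pullback_prj n X Y (E : @extension C n.+1 X Y) :
  exists M (g : {linear u M -> u X}) (E' : @extension C n.+1 M Y)
      (E0 : @extension C n.+1 Z Y),
    [/\ surj g, @extension_morphism C n.+1 M X Y g E' E &
        @extension_morphism C n.+1 M Z Y (\0 : {linear u M -> u Z}) E' E0].
Proof.
case: n E => [|n] E.
  have [E' [E'E E'0]] := ses_pullback_prj E.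
  by exists (ses_mid E), (prj E), E', (ses_left0 Y); split=> //; exact: prj_surj.
have [E' [E'E E'0]] := ses_pullback_prj (projT2 E).1.
exists (ses_mid (projT2 E).1), (prj (projT2 E).1).
exists (existT _ (projT1 E) (E', (projT2 E).2)).
exists (existT _ (projT1 E) (ses_left0 (projT1 E), (projT2 E).2)).
split; first exact: prj_surj.
  by exists (@idm C _); split=> //; exact: extension_morphism_refl.
by exists (@idm C _); split=> //; exact: extension_morphism_refl.
Qed.

(* If short exact sequences ending in X lift along surjections, the           *)
(* connecting morphism of a longer extension can be made to factor through    *)
(* the second middle term, which kills the extension.                         *)
Lemma lifting_trivial X :
  (forall K M (E : short_exact_sequence (C := C) X K) (g : {linear u M -> u K}),
    surj g -> exists E' : short_exact_sequence (C := C) X M,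
      @ses_morphism C _ _ _ _ (@idm C X) g E' E) ->
  forall n Y (E : @extension C n.+2 X Y),
    yoneda_equivalent E (trivial_extension n X Y).
Proof.
move=> liftX n Y [K [E F]].
have [M [g [F' [F0 [g_surj F'F F'0]]]]] := extension_pullback_prj F.
have [E' E'E] := liftX K M E g g_surj.
(* [(E', F')] maps to [(E, F)] with [g] on the spliced term, and to [(ses_right0 X, F0)] with 0
   there. The trivial extension also maps to the latter. *)
apply: (@rst_trans _ _ _ (existT _ M (E', F') : @extension C n.+2 X Y)).
  by apply/rst_sym/rst_step; exists g.
apply: (@rst_trans _ _ _ (existT _ Z (ses_right0 X, F0) : @extension C n.+2 X Y)).
  apply: rst_step; exists (\0 : {linear u M -> u Z}); split=> //.
  exact: ses_right0_terminal.
apply/rst_sym/rst_step; exists (\0 : {linear u Z -> u Z}).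
split; last exact: trivial0_initial.
apply/ses_morphismP; exists idfun; split=> x //=.
Qed.

(** Dimension shifting: since [E'] maps to [E] by [k], the tail [F] can be replaced by its pullback
    along [k], an extension of [K'], which is trivial by assumption. *)
Lemma effaceable_trivial n X Y :
  (forall K (E : short_exact_sequence (C := C) X K),
    exists K' (E' : short_exact_sequence (C := C) X K') (k : {linear u K' -> u K}),
      @ses_morphism C _ _ _ _ (@idm C X) k E' E /\
      forall F : @extension C n.+2 K' Y, yoneda_equivalent F (trivial_extension n K' Y)) ->
  forall E : @extension C n.+3 X Y, yoneda_equivalent E (trivial_extension n.+1 X Y).
Proof.
move=> effX [K [E F]].
have [K' [E' [k [E'E trivK']]]] := effX K E.
have [F' F'F] := @extension_pullback n.+1 _ _ _ k F.
apply: (@rst_trans _ _ _ (existT _ K' (E', F') : @extension C n.+3 X Y)).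
  by apply/rst_sym/rst_step; exists k.
apply: rst_trans (yoneda_equivalent_splice E' (trivK' F')) _.
apply: rst_step; exists (\0 : {linear u K' -> u Z}); split.
  exact: ses_right0_terminal.
exists (\0 : {linear u Z -> u Z}); split; last exact: trivial0_initial.
by apply/ses_morphismP; exists \0; split=> x.
Qed.

Lemma trivial_Ext_vanishes n X Y :
  (forall E : @extension C n.+2 X Y, yoneda_equivalent E (trivial_extension n X Y)) ->
  @Ext_vanishes C n.+2 X Y.
Proof. by move=> E0 E E'; apply: rst_trans (E0 E) (rst_sym _ _ _ _ (E0 E')). Qed.

End Trivial.

(** * Unit modules *)

Section Restriction.
Variables (R S : pzRingType) (f : {rmorphism R -> S}).

Lemma restrict_linear (M N : lmodType S) (g : {linear M -> N}) :
  linear (g : restrict f M -> restrict f N).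
Proof. by move=> a x y; rewrite linearD -[a *: x]/(f a *: (x : M)) linearZ. Qed.
Definition restrict_map (M N : lmodType S) (g : {linear M -> N}) :
  {linear restrict f M -> restrict f N} := mklin (@restrict_linear M N g).

Lemma extend_map_pure (M N : lmodType R) (g : {linear M -> N}) s m :
  extend_map f g (pure f s m) = pure f s (g m).
Proof. by rewrite [LHS]adjoint_pure /= [LHS]scale_pure mulr1. Qed.

Lemma extend_lin_ext (M : lmodType R) (N : lmodType S)
    (g h : {linear extend f M -> N}) :
  (forall m, g (pure f 1 m) = h (pure f 1 m)) -> g =1 h.
Proof.
move=> gh q; elim/extend_ind: q => [s m||q IH|q r IHq IHr].
- by rewrite -[s]mulr1 -scale_pure !linearZ /= gh.
- by rewrite !linear0.
- by rewrite !linearN IH.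
- by rewrite !linearD IHq IHr.
Qed.

Lemma extend_map_surj (M N : lmodType R) (g : {linear M -> N}) :
  surj g -> surj (extend_map f g).
Proof.
move=> g_surj q; elim/extend_ind: q => [s n||q [x <-]|q r [x <-] [y <-]].
- by have [m <-] := g_surj n; exists (pure f s m); rewrite extend_map_pure.
- by exists 0; rewrite linear0.
- by exists (- x); rewrite linearN.
- by exists (x + y); rewrite linearD.
Qed.

(** Injectivity of [g] is exactness of [\0] followed by [g], a form to which flatness applies; and
    [\0] extends to 0 because [pure f 1 0 = 0]. *)
Lemma extend_map_inj (M N : lmodType R) (g : {linear M -> N}) :
  flat f -> injective g -> injective (extend_map f g).
Proof.
move=> f_flat g_inj.
have g_ex : exact_at (\0 : {linear M -> M}) g.
  move=> m; split=> [gm|[l <-]]; last exact: linear0.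
  by exists 0; apply: g_inj; rewrite gm /= linear0.
move=> x y xy; apply/eqP; rewrite -subr_eq0; apply/eqP.
have /(f_flat _ _ _ _ _ g_ex)[l <-] : extend_map f g (x - y) = 0.
  by rewrite linearB xy subrr.
have -> // : extend_map f (\0 : {linear M -> M}) =1 \0.
apply: (extend_lin_ext (h := \0)) => m; rewrite extend_map_pure /=.
by apply: (@addIr _ (pure f 1 0)); rewrite -pureDr add0r [RHS]add0r.
Qed.
End Restriction.

Lemma inj_surj_bijective (A B : Type) (f : A -> B) :
  injective f -> surj f -> bijective f.
Proof.
by move=> fi /choice[g gK]; exists g => // x; apply: fi; rewrite gK.
Qed.

Lemma bijective_surj (A B : Type) (f : A -> B) : bijective f -> surj f.
Proof. by case=> g _ gK y; exists (g y). Qed.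

(** * Unit structures on modules with a semilinear map *)

Section SemilinearUnit.
Variables (R : pzRingType) (f : {rmorphism R -> R}).
Hypothesis f_flat : flat f.

Definition unit_structure (M : lmodType R) (F : {linear M -> restrict f M}) : Prop :=
  bijective (adjoint F).

Section Exact.
Variables (A B D : lmodType R) (i : {linear A -> B}) (q : {linear B -> D}).
Variables (FA : {linear A -> restrict f A}) (FB : {linear B -> restrict f B}).
Variable FD : {linear D -> restrict f D}.
Hypotheses (iF : forall x, i (FA x) = FB (i x)) (qF : forall x, q (FB x) = FD (q x)).
Hypothesis iq : exact_at i q.

Lemma adjoint_natural (M N : lmodType R) (g : {linear M -> N})
    (F : {linear M -> restrict f M}) (F' : {linear N -> restrict f N}) :
  (forall x, g (F x) = F' (g x)) ->
  forall t, g (adjoint F t) = adjoint F' (extend_map f g t).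
Proof.
move=> gF; apply: (extend_lin_ext (g := g \o adjoint F)
  (h := adjoint F' \o extend_map f g)) => m /=.
by rewrite [in RHS]extend_map_pure !adjoint_pure !scale1r gF.
Qed.

Let iN := adjoint_natural iF.
Let qN := adjoint_natural qF.
Let eiq := f_flat iq.

(** By flatness the extended sequence stays exact, so the adjoints form a morphism of exact
    sequences. This lemma and the next two are diagram chases of five-lemma type in that
    morphism. *)
Lemma unit_kernel : injective i ->
  unit_structure FB -> unit_structure FD -> unit_structure FA.
Proof.
move=> i_inj uB uD; apply: inj_surj_bijective => [x y xy|a].
  apply: (extend_map_inj f_flat i_inj); apply: (bij_inj uB).
  by rewrite -!iN xy.
have [t tE] := bijective_surj uB (i a).
have /eiq[t' t'E] : extend_map f q t = 0.
  apply: (bij_inj uD); rewrite linear0 -qN tE.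
  by apply/iq; exists a.
by exists t'; apply: i_inj; rewrite iN t'E tE.
Qed.

Lemma unit_cokernel : surj q ->
  unit_structure FA -> unit_structure FB -> unit_structure FD.
Proof.
move=> q_surj uA uB; apply: inj_surj_bijective => [x y xy|d].
  apply/eqP; rewrite -subr_eq0; apply/eqP.
  have [t tE] := extend_map_surj q_surj (x - y).
  have : adjoint FD (x - y) = 0 by rewrite linearB xy subrr.
  rewrite -tE -qN => /iq[a aE]; apply/eiq.
  have [s sE] := bijective_surj uA a; exists s.
  by apply: (bij_inj uB); rewrite -iN sE.
have [b <-] := q_surj d; have [t <-] := bijective_surj uB b.
by exists (extend_map f q t); rewrite qN.
Qed.

Lemma unit_extension : injective i -> surj q ->
  unit_structure FA -> unit_structure FD -> unit_structure FB.
Proof.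
move=> i_inj q_surj uA uD; apply: inj_surj_bijective => [x y xy|b].
  apply/eqP; rewrite -subr_eq0; apply/eqP.
  have xy0 : adjoint FB (x - y) = 0 by rewrite linearB xy subrr.
  have /eiq[t tE] : extend_map f q (x - y) = 0.
    by apply: (bij_inj uD); rewrite -qN xy0 !linear0.
  rewrite -tE; suff -> : t = 0 by rewrite linear0.
  by apply: (bij_inj uA); apply: i_inj; rewrite iN tE xy0 !linear0.
have [d dE] := bijective_surj uD (q b).
have [t tE] := extend_map_surj q_surj d.
have /iq[a aE] : q (b - adjoint FB t) = 0 by rewrite linearB qN tE dE subrr.
have [s sE] := bijective_surj uA a.
exists (extend_map f i s + t).
by rewrite linearD -iN sE aE subrK.
Qed.
End Exact.

Lemma unit_zero (M : lmodType R) (F : {linear M -> restrict f M}) :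
  (forall x : M, x = 0) -> unit_structure F.
Proof.
move=> M0; apply: inj_surj_bijective => [x y _|y].
  have e0 : forall t : extend f M, t = 0.
    apply: (extend_lin_ext (g := idfun) (h := \0)) => m /=; rewrite (M0 m).
    by apply: (@addIr _ (pure f 1 0)); rewrite -pureDr add0r [RHS]add0r.
  by rewrite (e0 x) (e0 y).
by exists 0; rewrite (M0 y) linear0.
Qed.

Lemma unit_twist (M : lmodType R) (F : {linear M -> restrict f M})
    (g : {linear M -> M}) :
  bijective g -> unit_structure F ->
  unit_structure (restrict_map f g \o F : {linear M -> restrict f M}).
Proof.
move=> g_bij uF.
apply: (eq_bij (bij_comp g_bij uF)).
apply: (extend_lin_ext (g := g \o adjoint F) (h := adjoint _)) => m /=.
by rewrite !adjoint_pure !scale1r.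
Qed.

(** The coordinatewise [f]. Its adjoint is bijective because base change of a free module is free on
    the same basis. *)
Definition free_frobenius (S : Type) :
  {linear free_module R S -> restrict f (free_module R S)} :=
  free_lift (N := restrict f (free_module R S)) (@gen R S).

Lemma free_frobenius_gen S s : free_frobenius S (gen R s) = gen R s.
Proof. exact: (@free_lift_gen R S (restrict f (free_module R S))). Qed.

Lemma free_frobenius_unit S : unit_structure (free_frobenius S).
Proof.
pose g := free_lift (fun s : S => pure f 1 (gen R s)).
have gE s : g (gen R s) = pure f 1 (gen R s).
  exact: (free_lift_gen (fun s : S => pure f 1 (gen R s))).
exists g.
  apply: (extend_lin_ext (g := g \o adjoint _) (h := idfun)) => m.
  rewrite /= adjoint_pure scale1r.
  apply: (@free_lin_ext _ _ (restrict f (extend f _))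
    (restrict_map f g \o free_frobenius S) (@extend_unit _ _ f _)) => s.
  exact: etrans (congr1 g (free_frobenius_gen s)) (gE s).
apply: (@free_lin_ext _ _ _ (adjoint (free_frobenius S) \o g) idfun) => s.
apply: etrans (congr1 (adjoint (free_frobenius S)) (gE s)) _.
by rewrite [LHS]adjoint_pure scale1r free_frobenius_gen.
Qed.

Section Product.
Variables (M N : lmodType R) (FM : {linear M -> restrict f M}).
Variables (FN : {linear N -> restrict f N}) (d : {linear N -> restrict f M}).

Lemma twisted_product_linear :
  linear (fun z : M * N => (FM z.1 + d z.2, FN z.2) : restrict f (M * N)%type).
Proof.
move=> a [x y] [x' y'] /=; rewrite !linearP /=; congr (_, _) => /=.
by rewrite addrACA -[RHS]/(f a *: (_ + _ : M) + _) scalerDr.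
Qed.
(** The structure on an extension of [N] by [M] that splits over [R], with [d] as its cocycle. *)
Definition twisted_product : {linear (M * N)%type -> restrict f (M * N)%type} :=
  mklin twisted_product_linear.

Lemma inl_linear : linear (fun m : M => (m, 0 : N)).
Proof. by move=> a x y; congr (_, _) => /=; rewrite scaler0 addr0. Qed.
Definition inl_lin : {linear M -> (M * N)%type} := mklin inl_linear.

Lemma inl_exact : exact_at inl_lin (snd : {linear (M * N)%type -> N}).
Proof.
move=> [x y]; split=> /= [->|[z [_ <-]]] //.
by exists x.
Qed.

Lemma twisted_product_unit :
  unit_structure FM -> unit_structure FN -> unit_structure twisted_product.
Proof.
apply: (unit_extension (i := inl_lin) (q := snd)) => //.
- by move=> x; congr (_, _) => /=; rewrite linear0 ?addr0.
- exact: inl_exact.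
- by move=> x y [].
- by move=> y; exists (0, y).
Qed.
End Product.
End SemilinearUnit.

(** * [R[F]]-modules as [R]-modules with a Frobenius-semilinear map *)

Section FrobeniusModule.
Variables (R : comPzRingType) (p : nat) (p_prime : prime p) (p0 : p%:R = 0 :> R).
Let phi : {rmorphism R -> R} := frobenius p_prime p0.

Lemma frobring_linear (M N : lmodType (frobring R p))
    (g : {linear base_module M -> base_module N}) :
  (forall x, g (F_action p_prime p0 M x) = F_action p_prime p0 N (g x)) ->
  linear (g : M -> N).
Proof.
move=> gF q x y; rewrite -[LHS]/(g (_ + _)) linearD; congr (_ + _).
rewrite -(fclassK q); elim: (repr q) x => {q y} [a||t IH|s IHs t IHt|s IHs t IHt] x.
- exact: (linearZ_LR g a x).
- exact: gF.
- rewrite fclassN (@scaleNr _ M) (@scaleNr _ N) -IH; exact: (linearN g).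
- rewrite fclassD (@scalerDl _ M) (@scalerDl _ N) -IHs -IHt; exact: (linearD g).
- by rewrite fclassM -(@scalerA _ M) -(@scalerA _ N) IHs IHt.
Qed.

Section Build.
Variables (M : lmodType R) (F : {linear M -> restrict phi M}).

(** The inert [let] makes [F] a parameter of the type, so that different [F] on the same [M] carry
    different module structures. *)
Definition frobenius_module : Type := let _ := F in M.
HB.instance Definition _ := GRing.Zmodule.on frobenius_module.

Fixpoint fterm_eval (t : fterm R) (m : M) : M :=
  match t with
  | FConst a => a *: m
  | FVar => F m
  | FOpp t => - fterm_eval t m
  | FAdd s t => fterm_eval s m + fterm_eval t m
  | FMul s t => fterm_eval s (fterm_eval t m)
  end.

Let evalD t m n : fterm_eval t (m + n) = fterm_eval t m + fterm_eval t n.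
Proof.
elim: t m n => [a||t IH|s IHs t IHt|s IHs t IHt] m n /=.
- by rewrite scalerDr.
- by rewrite linearD.
- by rewrite IH opprD.
- by rewrite IHs IHt addrACA.
- by rewrite IHt IHs.
Qed.

Let eval_feq s t : feq p s t -> fterm_eval s =1 fterm_eval t.
Proof.
elim=> {s t} //=.
- by move=> s t _ st m; rewrite st.
- by move=> t s r _ st _ tr m; rewrite st tr.
- by move=> s t _ st m; rewrite st.
- by move=> s s' t t' _ ss' _ tt' m; rewrite ss' tt'.
- by move=> s s' t t' _ ss' _ tt' m; rewrite tt' ss'.
- by move=> s t r m; rewrite addrA.
- by move=> s t m; rewrite addrC.
- by move=> s m; rewrite scale0r add0r.
- by move=> s m; rewrite scale0r addNr.
- by move=> s m; rewrite scale1r.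
- by move=> s m; rewrite scale1r.
- by move=> s t r m; rewrite evalD.
- by move=> a b m; rewrite scalerDl.
- by move=> a b m; rewrite scalerA.
- by move=> a m; rewrite linearZ.
Qed.

Let scale (q : frobring R p) (m : frobenius_module) : frobenius_module :=
  fterm_eval (repr q) m.

Let scaleE t m : scale (fclass p t) m = fterm_eval t m.
Proof. exact/eval_feq/repr_fclass. Qed.

Let scaleA q r m : scale q (scale r m) = scale (q * r) m.
Proof.
by rewrite -(fclassK q) -(fclassK r) -fclassM !scaleE.
Qed.
Let scale1 : left_id 1 scale.
Proof. by move=> m; rewrite [LHS]scaleE /= scale1r. Qed.
Let scaleDr : right_distributive scale +%R.
Proof. by move=> q m n; apply: evalD. Qed.
Let scaleDl m : {morph scale^~ m : q r / q + r}.
Proof.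
by move=> q r; rewrite -(fclassK q) -(fclassK r) -fclassD !scaleE.
Qed.
HB.instance Definition _ := GRing.Zmodule_isLmodule.Build (frobring R p)
  frobenius_module scaleA scale1 scaleDr scaleDl.

Lemma frobenius_module_var (m : frobenius_module) : fvar R p *: m = F m.
Proof. exact: scaleE. Qed.

(** Scalars of [R[F]] act through a chosen representative term, so the two [R]-actions agree only up
    to a proof. [to_base] and [of_base] package the identity as a linear map each way. *)
Lemma to_base_linear : linear (id : M -> base_module frobenius_module).
Proof.
move=> a m n; congr (_ + _).
exact/esym/(scaleE (FConst a)).
Qed.
Definition to_base : {linear M -> base_module frobenius_module} :=
  mklin to_base_linear.

Lemma of_base_linear : linear (id : base_module frobenius_module -> M).
Proof.
move=> a m n; congr (_ + _).
exact: (scaleE (FConst a)).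
Qed.
Definition of_base : {linear base_module frobenius_module -> M} :=
  mklin of_base_linear.

Lemma frobenius_module_projective :
  projective M -> projective (base_module frobenius_module).
Proof.
move=> M_proj V W g h g_surj.
have [k kP] := M_proj V W g (h \o to_base) g_surj.
by exists (k \o of_base) => x; rewrite /= kP.
Qed.

(** The isomorphism [of_base] is viewed as the kernel of a zero map, so that [unit_kernel]
    transports the unit structure. *)
Lemma frobenius_module_unit : flat phi ->
  unit_structure F -> is_unit_module p_prime p0 frobenius_module.
Proof.
move=> phi_flat uF.
apply: (unit_kernel phi_flat (i := of_base) (q := \0 : {linear M -> M})
  (FB := F) (FD := F)) => //.
- by move=> x; rewrite /= [LHS]frobenius_module_var.
- by move=> x; rewrite /= linear0.
- by move=> m; split=> // _; exists m.
Qed.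
End Build.
End FrobeniusModule.

(** * The category of unit modules *)

Section UnitCategory.
Variables (R : comPzRingType) (p : nat) (p_prime : prime p) (p0 : p%:R = 0 :> R).
Let phi : {rmorphism R -> R} := frobenius p_prime p0.
Hypothesis phi_flat : flat phi.
Notation unit_object := {M : lmodType (frobring R p) | is_unit_module p_prime p0 M}.
Let u : unit_object -> lmodType (frobring R p) := sval.
Notation C := (concrete u).
Notation act := (F_action p_prime p0).

Definition base_map (M N : lmodType (frobring R p)) (g : {linear M -> N}) :
  {linear base_module M -> base_module N} := restrict_map _ g.

Lemma base_mapF (M N : lmodType (frobring R p)) (g : {linear M -> N}) x :
  base_map g (act M x) = act N (base_map g x).
Proof. exact: (linearZ_LR g). Qed.

Lemma unit_has_zero : has_zero u.
Proof.
have [Z Z0] := module_has_zero (frobring R p).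
by exists (exist _ Z (unit_zero (act Z) Z0)).
Qed.

Lemma unit_ker_type (M N : lmodType (frobring R p)) (g : {linear M -> N}) :
  is_unit_module p_prime p0 M -> is_unit_module p_prime p0 N ->
  is_unit_module p_prime p0 (ker_type g).
Proof.
apply: (unit_kernel phi_flat (i := base_map (ker_inc g)) (q := base_map g)).
- exact: base_mapF.
- exact: base_mapF.
- exact: (@ker_incP _ _ _ g).
- exact: (@ker_inc_inj _ _ _ g).
Qed.

Lemma unit_has_kernels : has_kernels u.
Proof.
move=> [M uM] [N uN] g; exists (exist _ _ (unit_ker_type g uM uN)), (ker_inc g).
by split; [exact: (@ker_inc_inj _ _ _ g) | exact: (@ker_incP _ _ _ g)].
Qed.

Lemma unit_has_cokernels : has_cokernels u.
Proof.
move=> [M uM] [N uN] g.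
have uQ : is_unit_module p_prime p0 (coker_type g).
  apply: (unit_cokernel phi_flat (i := base_map g) (q := base_map (coker_prj g))
    _ _ _ _ uM uN).
  - exact: base_mapF.
  - exact: base_mapF.
  - exact: (@coker_prjP _ _ _ g).
  - exact: (@coker_prj_surj _ _ _ g).
exists (exist _ _ uQ), (coker_prj g).
by split; [exact: (@coker_prj_surj _ _ _ g) | exact: (@coker_prjP _ _ _ g)].
Qed.

Lemma unit_has_products : has_products u.
Proof.
move=> [M uM] [N uN].
have uW : is_unit_module p_prime p0 (M * N)%type.
  apply: (unit_extension phi_flat (i := base_map (inl_lin M N))
    (q := base_map (snd : {linear (M * N)%type -> N})) _ _ _ _ _ uM uN).
  - exact: base_mapF.
  - exact: base_mapF.
  - exact: (@inl_exact _ M N).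
  - by move=> x y [].
  - by move=> y; exists (0, y).
exists (exist _ _ uW), idfun; split=> // x.
by exists x.
Qed.

(* A surjection from a free R-module P onto a unit module X need not lift to a *)
(* unit structure on P, but (pi, 0) : P * P -> X is one up to an automorphism  *)
(* of P * P, as in Schanuel's lemma.                                           *)
Lemma unit_free_cover (X : lmodType (frobring R p)) : is_unit_module p_prime p0 X ->
  exists (Q : unit_object) (g : {linear u Q -> X}),
    projective (base_module (u Q)) /\ surj g.
Proof.
move=> uX; pose P : lmodType R := free_module R X.
have [F [uF FE]] : exists F : {linear P -> restrict phi P},
    unit_structure F /\ forall x, F (gen R x) = gen R x.
  by exists (free_frobenius phi X); split=> [|x];
    [exact: free_frobenius_unit | exact: free_frobenius_gen].
have [pi piE] := free_lift_exists (id : X -> base_module X).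
have [G GE] := free_lift_exists (fun x : X => gen R (act X x : X)).
(* Thus [pi] carries [G \o F] to the action on [X]; but [G] may fail to be bijective, so [G \o F]
   need not be a unit structure. *)
have piGF x : pi (G (F x)) = act X (pi x).
  apply: (@free_lin_ext _ _ (restrict phi (base_module X))
    (restrict_map phi (pi \o G) \o F) (act X \o pi)) => s.
  by apply: etrans (congr1 (fun t => pi (G t)) (FE s)) _; rewrite GE /= !piE.
(* The adjoint of the action is surjective, so the elements [F x] span [X] over [R]. *)
have piG_surj : surj (pi \o G).
  move=> x; have [t <-] := bijective_surj uX x.
  elim/extend_ind: t => [a m||q [z zE]|q r [z zE] [z' z'E]].
  - by exists (a *: gen R (m : X)); rewrite linearZ /= GE piE adjoint_pure.
  - by exists 0; rewrite !linear0.
  - by exists (- z); rewrite [LHS](linearN (pi \o G)) linearN -zE.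
  - by exists (z + z'); rewrite [LHS](linearD (pi \o G)) linearD -zE -z'E.
have [c cP] := choice (fun x : X => piG_surj x).
have [A A_gen] := free_lift_exists c.
have AE z : pi (G (A z)) = pi z.
  apply: (@free_lin_ext _ _ _ (pi \o G \o A) pi) => s.
  by apply: etrans (congr1 (fun t => pi (G t)) (A_gen s)) _; rewrite piE; apply: cP.
(* A composite of two shears and a swap, hence invertible. Since [pi G A = pi], it satisfies
   [pi (T0 z).1 = pi (G z.1)]: seen from [X] it acts as [G], and it is bijective. *)
pose T0 (z : P * P) : P * P := (z.2 + G (z.1 - A z.2), z.1 - A z.2).
have T0L : linear T0.
  move=> a [x y] [x' y']; rewrite /T0 /=.
  have E : a *: x + x' - A (a *: y + y') = a *: (x - A y) + (x' - A y').
    by rewrite linearP opprD addrACA scalerBr.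
  rewrite E linearP; congr (_, _) => /=.
  by rewrite addrACA scalerDr.
pose T : {linear (P * P)%type -> (P * P)%type} := mklin T0L.
have T_bij : bijective T.
  exists (fun z => (z.2 + A (z.1 - G z.2), z.1 - G z.2)) => -[x y]; rewrite /T /= /T0 /=.
    by rewrite addrK subrK.
  by rewrite addrK subrK.
pose F2 := twisted_product F F (\0 : {linear P -> restrict phi P}).
have uF2 : unit_structure F2.
  exact: twisted_product_unit.
have uFQ := unit_twist T_bij uF2.
set FQ : {linear _ -> _} := (restrict_map _ _ \o _ : {linear _ -> _}) in uFQ.
pose Q : unit_object := exist _ _ (frobenius_module_unit phi_flat uFQ).
pose g0 : {linear base_module (u Q) -> base_module X} := pi \o fst \o of_base FQ.
have g0L : linear (g0 : u Q -> X).
  apply: (@frobring_linear _ _ p_prime p0) => -[x y].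
  apply: etrans (_ : pi (T (F2 (x, y))).1 = _).
    by congr (pi _.1); apply: frobenius_module_var.
  rewrite /T /= /T0 /= !addr0 !linearD !linearN /=.
  by rewrite AE piGF addrC subrK.
exists Q, (mklin g0L); split.
  apply: frobenius_module_projective; apply: prod_projective; exact: free_projective.
by move=> x; exists ((gen R x, 0) : P * P); rewrite /= [LHS]piE.
Qed.

Let z := unit_has_zero.

(* Over R the sequence splits, so it is given by a Frobenius-semilinear map   *)
(* X -> K, which lifts along M -> K since X is projective over R.             *)
Lemma projective_lifting (X : unit_object) : projective (base_module (u X)) ->
  forall K M (E : short_exact_sequence (C := C) X K) (g : {linear u M -> u K}),
    surj g -> exists E' : short_exact_sequence (C := C) X M,
      @ses_morphism C _ _ _ _ (@idm C X) g E' E.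
Proof.
move=> X_proj K M E g g_surj.
have [E_inj E_ex] := inc_exact z E unit_has_kernels.
have E_surj := prj_surj z E unit_has_cokernels.
have [s sP] := X_proj _ _ (base_map (prj E)) idfun E_surj.
(* The failure of the section [s] to commute with [F]. It is killed by [prj E], hence comes from a
   semilinear [d] into [K]. *)
pose d0 : {linear base_module (u X) -> restrict phi (base_module (mid E))} :=
  (act (mid E) \o s) \- (restrict_map phi s \o act (u X)).
have [d dP] : exists d : {linear base_module (u X) -> restrict phi (base_module (u K))},
    forall x, restrict_map phi (base_map (inc E)) (d x) = d0 x.
  apply: (lift_kernel (i := restrict_map phi (base_map (inc E)))
    (f := restrict_map phi (base_map (prj E))) E_inj E_ex) => x.
  rewrite /d0 linearB; apply/eqP; rewrite subr_eq0; apply/eqP.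
  apply: etrans (base_mapF (prj E) (s x)) _.
  by rewrite sP; apply/esym/sP.
have [d' d'P] := X_proj _ _ (restrict_map phi (base_map g)) d g_surj.
pose FE := twisted_product (act (u M)) (act (u X)) d'.
have uFE : unit_structure FE.
  exact: (twisted_product_unit phi_flat _ (svalP M) (svalP X)).
pose N : unit_object := exist _ _ (frobenius_module_unit phi_flat uFE).
pose i0 : {linear base_module (u M) -> base_module (u N)} := to_base FE \o inl_lin _ _.
have i0L : linear (i0 : u M -> u N).
  apply: (@frobring_linear _ _ p_prime p0) => m.
  rewrite [RHS](@frobenius_module_var _ _ _ _ _ FE _); congr (_, _) => /=.
    by rewrite linear0 addr0.
  by rewrite linear0.
pose q0 : {linear base_module (u N) -> base_module (u X)} := snd \o of_base FE.
have q0L : linear (q0 : u N -> u X).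
  apply: (@frobring_linear _ _ p_prime p0) => m.
  by rewrite /q0 /= [X in X.2](@frobenius_module_var _ _ _ _ _ FE _).
(* This [(m, x) |-> inc (g m) + s x] commutes with [F] because [inc g d' = F s - s F]. *)
pose e0 : {linear base_module (u N) -> base_module (mid E)} :=
  ((base_map (inc E) \o base_map g \o fst) \+ (s \o snd)) \o of_base FE.
have e0L : linear (e0 : u N -> mid E).
  apply: (@frobring_linear _ _ p_prime p0) => -[m x].
  have -> : act (u N) (m, x) = FE (m, x) by exact: frobenius_module_var.
  have Ed' : inc E (g (d' x)) = act (mid E) (s x) - s (act (u X) x).
    by apply: etrans (dP x); congr (inc E _); apply: d'P.
  have Fm : inc E (g (act (u M) m)) = act (mid E) (inc E (g m)).
    exact: (base_mapF (inc E \o g) m).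
  rewrite /e0 /= linearD [RHS]linearD.
  apply: etrans (congr2 +%R (etrans (linearD (inc E) _ _) (congr2 +%R Fm Ed')) erefl) _.
  by rewrite -addrA subrK.
have i_inj : injective (mklin i0L) by move=> x y [].
have q_surj : surj (mklin q0L) by move=> x; exists (0, x).
have iq : exact_at (mklin i0L) (mklin q0L) by exact: inl_exact.
exists (@make_ses _ _ u z X N M _ _ i_inj q_surj iq); apply/ses_morphismP.
exists (mklin e0L); split=> [m|[m x]] /=.
  by rewrite linear0 addr0.
by rewrite linearD [X in X + _](inc_prj z unit_has_kernels) add0r [LHS]sP.
Qed.

(** For [X] projective over [R], length 2 suffices, and each further projective dimension costs one
    more. [m] is the excess length, unchanged by the induction. *)
Lemma pd_le_trivial (Z : unit_object) (Z0 : forall x : u Z, x = 0) n m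
    (X Y : unit_object) :
  pd_le n (base_module (u X)) -> forall E : @extension C (n + m).+2 X Y,
  yoneda_equivalent E (trivial_extension z Z0 (n + m) X Y).
Proof.
have zk := unit_has_kernels; have zc := unit_has_cokernels.
have zp := unit_has_products.
elim: n X => [|n IH] X pdX.
  exact: (lifting_trivial z zk zc zp Z0 (projective_lifting pdX)).
rewrite addSn; apply: (effaceable_trivial zk zc zp) => K E.
have [E_inj E_ex] := inc_exact z E zk; have E_surj := prj_surj z E zc.
(* Covering the middle term of [E] rather than [X] makes the new sequence map to [E]; its kernel is
   a syzygy of [X] over [R], of smaller projective dimension. *)
have [Q [g [Q_proj g_surj]]] := unit_free_cover (svalP (ses_mid E)).
pose q : {linear u Q -> u X} := prj E \o g.
have q_surj : surj q.
  by move=> x; have [y <-] := E_surj x; have [t <-] := g_surj y; exists t.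
pose K' : unit_object := exist _ _ (unit_ker_type q (svalP Q) (svalP X)).
pose i : {linear u K' -> u Q} := ker_inc q.
have i_inj : injective i := @ker_inc_inj _ _ _ q.
have iq : exact_at i q := @ker_incP _ _ _ q.
have [k kP] : exists k : {linear u K' -> u K}, forall x, inc E (k x) = g (i x).
  by apply: (lift_kernel (u := g \o i) E_inj E_ex) => x; apply/iq; exists x.
exists K', (@make_ses _ _ u z X Q K' _ _ i_inj q_surj iq), k; split.
  by apply/ses_morphismP; exists g; split=> x //=; rewrite kP.
apply: IH.
exact: (pdX _ _ (base_map q) (base_map i) Q_proj q_surj i_inj iq).
Qed.
End UnitCategory.

Theorem corollary6p9 (p : nat) (p_prime : prime p) (R : comPzRingType)
    (p0 : (p%:R = 0 :> R)%R) (frob_flat : flat (frobenius p_prime p0))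
    (d : nat) (R_gldim : has_gldim (module_category R) d) :
  gldim_le (unit_category p_prime p0) d.+1.
Proof.
rewrite /unit_category concrete_full => i d_lt_i X Y.
have [Z Z0] := unit_has_zero p_prime p0.
have pdX : pd_le d (base_module (sval X)).
  by apply: Ext_vanishes_pd_le => N; apply: R_gldim.1.
(* [d] for the syzygies, 2 for the length from which extensions of modules projective over [R] are
   trivial, and the rest as excess. *)
have -> : i = (d + (i - d.+2)).+2 by rewrite -!addSn subnKC.
exact: (trivial_Ext_vanishes (pd_le_trivial frob_flat Z0 pdX)).
Qed.
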